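(* For all partitions $\lambda,\mu$: $\omega(G^{\beta}_{\lambda/\!\!/\mu}) = J^{\beta}_{\lambda/\!\!/\mu}$ and $\omega(g^{\beta}_{\lambda/\mu}) = j^{\beta}_{\lambda/\mu}$.
   Context: $\omega$ is the involutive ring automorphism of symmetric functions (coefficients in $\mathbb{Z}[\beta]$) with $\omega(s_\lambda)=s_{\lambda'}$, extended to infinite linear combinations of Schur functions. Setting: $\beta$ is a scalar; $\mathbb{Z}[\beta]P$ is the free module on partitions with pairing $\langle\lambda,\mu\rangle=\delta_{\lambda\mu}$; $u_i$ (resp. $d_i$) adds (resp. removes) a box in column $i$ (giving $0$ if not a partition); $\widetilde u_i=u_i(1-\beta d_i)$, $\widetilde d_i=\sum_{k\ge1}\beta^{k-1}d_i^k$; $A(x)=\cdots(1+x\widetilde u_2)(1+x\widetilde u_1)$, $B(x)=(1+x\widetilde d_1)(1+x\widetilde d_2)\cdots$, $\overline A(x)=(1-x\widetilde u_1)^{-1}(1-x\widetilde u_2)^{-1}\cdots$, $\overline B(x)=\cdots(1-x\widetilde d_2)^{-1}(1-x\widetilde d_1)^{-1}$ (inverses as geometric series). Define $G^\beta_{\lambda/\!\!/\mu}(x_1,\ldots,x_n)=\langle A(x_n)\cdots A(x_1)\mu,\lambda\rangle$, $g^\beta_{\lambda/\mu}=\langle B(x_n)\cdots B(x_1)\lambda,\mu\rangle$, $J^\beta_{\lambda/\!\!/\mu}=\langle\overline A(x_n)\cdots\overline A(x_1)\mu,\lambda\rangle$, $j^\beta_{\lambda/\mu}=\langle\overline B(x_n)\cdots\overline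 B(x_1)\lambda,\mu\rangle$; these are symmetric in $x_1,\dots,x_n$ and extend to symmetric functions in infinitely many variables. *)

(* Defs.v *)
From HB Require Import structures.
From mathcomp Require Import all_boot all_order all_algebra.
From mathcomp Require Import boolp classical_sets functions cardinality fsbigop.
From mathcomp.multinomials Require Import freeg.

Set Implicit Arguments.
Unset Strict Implicit.
Unset Printing Implicit Defensive.
Import GRing.Theory.
Local Open Scope classical_set_scope.
Local Open Scope ring_scope.

(** Every sum [\sum_(i \in D) F i] over an infinite [D] below has finite
    support, so the default value of [fsbigop] is never used. *)

(** * Partitions *)

Definition is_part (s : seq nat) : bool := sorted geq s && (0%N \notin s).

Definition intpart : Type := {s : seq nat | is_part s}.

(** Columns are numbered from 0: [collen la j] is the length of the column
    usually numbered [j + 1]. *)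
Definition collen (la : intpart) (j : nat) : nat := count (ltn j) (val la).

Definition conj_seq (la : intpart) : seq nat :=
  mkseq (collen la) (head 0%N (val la)).

Lemma conj_seqP (la : intpart) : is_part (conj_seq la).
Proof.
apply/andP; split.
  apply: (homo_sorted _ _ (iota_sorted 0 _)) => i j le_ij /=.
  by apply: sub_count => r /=; apply: leq_ltn_trans.
apply/negP => /mapP[i]; rewrite mem_iota add0n /= /collen.
by case: la => -[//|r s] /= _ ->.
Qed.

Definition conj_part (la : intpart) : intpart :=
  exist _ (conj_seq la) (conj_seqP la).

(** [mu] is [la] with one box added in column [j]; for given [j], each of [la]
    and [mu] determines the other. *)
Definition adds_box (j : nat) (la mu : intpart) : Prop :=
  forall k, collen mu k = (collen la k + (k == j))%N.

(** * The operators on the free module on partitions *)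

Notation RP R := {freeg intpart / R}.

Definition pbasis (R : comNzRingType) (la : intpart) : RP R := << la >>.

Definition up (R : comNzRingType) (i : nat) : RP R -> RP R :=
  fglift (fun la => \sum_(mu \in [set mu | adds_box i la mu]) pbasis R mu).

Definition dn (R : comNzRingType) (i : nat) : RP R -> RP R :=
  fglift (fun la => \sum_(mu \in [set mu | adds_box i mu la]) pbasis R mu).

Definition upt (R : comNzRingType) (beta : R) (i : nat) (v : RP R) : RP R :=
  up i (v - beta *: dn i v).

Definition dnt (R : comNzRingType) (beta : R) (i : nat) (v : RP R) : RP R :=
  \sum_(k \in [set k : nat | (0 < k)%N]) beta ^+ k.-1 *: iter k (dn i) v.

(** * Power series in one variable with operator coefficients *)

(** [T : opser R] stands for the sum of the [x ^ k * T k]. *)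
Definition opser (R : comNzRingType) := nat -> RP R -> RP R.

Definition op1 (R : comNzRingType) : opser R :=
  fun k v => if k is 0%N then v else 0.

Definition opmul (R : comNzRingType) (S T : opser R) : opser R :=
  fun k v => \sum_(j < k.+1) S j (T (k - j)%N v).

(** [1 + x T] *)
Definition opD1 (R : comNzRingType) (T : RP R -> RP R) : opser R :=
  fun k v => match k with 0%N => v | 1%N => T v | _ => 0 end.

(** [(1 - x T)^-1] *)
Definition opgeom (R : comNzRingType) (T : RP R -> RP R) : opser R :=
  fun k v => iter k T v.

(** [F (N - 1) ... F 1 F 0] *)
Fixpoint oprodl (R : comNzRingType) (F : nat -> opser R) (N : nat) : opser R :=
  if N is N'.+1 then opmul (F N') (oprodl F N') else @op1 R.

(** [F 0 F 1 ... F (N - 1)] *)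
Fixpoint oprodr (R : comNzRingType) (F : nat -> opser R) (N : nat) : opser R :=
  if N is N'.+1 then opmul (oprodr F N') (F N') else @op1 R.

(** The value at which [s] stabilises. *)
Definition stable_value (T : choiceType) (x0 : T) (s : nat -> T) : T :=
  xget x0 [set v | exists N, forall n, (N <= n)%N -> s n = v].

(** The infinite products are limits of the finite ones, each coefficient
    applied to a given vector being eventually constant. *)
Definition oplim (R : comNzRingType) (P : nat -> opser R) : opser R :=
  fun k v => stable_value 0 (fun N => P N k v).

Definition opA (R : comNzRingType) (beta : R) : opser R :=
  oplim (oprodl (fun i => opD1 (upt beta i))).

Definition opB (R : comNzRingType) (beta : R) : opser R :=
  oplim (oprodr (fun i => opD1 (dnt beta i))).

Definition opAbar (R : comNzRingType) (beta : R) : opser R :=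
  oplim (oprodr (fun i => opgeom (upt beta i))).

Definition opBbar (R : comNzRingType) (beta : R) : opser R :=
  oplim (oprodl (fun i => opgeom (dnt beta i))).

(** * Symmetric functions *)

(** [f : symser R] is a family of formal power series [f(x_1, ..., x_n)], one
    for each [n]: [f [:: a_1; ...; a_n]] is the coefficient of
    [x_1 ^ a_1 ... x_n ^ a_n] in [f(x_1, ..., x_n)]. Symmetric functions in
    infinitely many variables are the families of symmetric series that are
    compatible with setting [x_n = 0], that is, [f (rcons a 0) = f a]. *)
Definition symser (R : comNzRingType) := seq nat -> R.

(** The coefficient of [x_1 ^ a_1 ... x_n ^ a_n] in [T(x_n) ... T(x_1) v]. *)
Definition opcoef (R : comNzRingType) (T : opser R) (v : RP R) (a : seq nat) :
    RP R :=
  foldl (fun w k => T k w) v a.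

Definition Gbeta (R : comNzRingType) (beta : R) (la mu : intpart) : symser R :=
  fun a => coeff la (opcoef (opA beta) (pbasis R mu) a).

Definition gbeta (R : comNzRingType) (beta : R) (la mu : intpart) : symser R :=
  fun a => coeff mu (opcoef (opB beta) (pbasis R la) a).

Definition Jbeta (R : comNzRingType) (beta : R) (la mu : intpart) : symser R :=
  fun a => coeff la (opcoef (opAbar beta) (pbasis R mu) a).

Definition jbeta (R : comNzRingType) (beta : R) (la mu : intpart) : symser R :=
  fun a => coeff mu (opcoef (opBbar beta) (pbasis R la) a).

(** A tableau is the sequence of its rows. *)
Definition is_ssyt (la : intpart) (T : seq (seq nat)) : Prop :=
  [/\ shape T = val la,
      all (sorted leq) T &
      forall r c, (c < size (nth [::] T r.+1))%N ->
        (nth 0 (nth [::] T r) c < nth 0 (nth [::] T r.+1) c)%N].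

(** The variable [x_(i + 1)] is associated with the entry [i]. *)
Definition has_content (T : seq (seq nat)) (a : seq nat) : Prop :=
  forall i, count_mem i (flatten T) = nth 0%N a i.

Definition schur (R : comNzRingType) (la : intpart) : symser R :=
  fun a => \sum_(T \in [set T | is_ssyt la T /\ has_content T a]) (1 : R).

(** [c] is unique, if it exists, because the Schur functions are linearly
    independent, also for infinite combinations. It exists exactly when [f] is a
    symmetric function (of possibly unbounded degree). *)
Definition schur_coefs (R : comNzRingType) (f : symser R) : intpart -> R :=
  xget (fun _ => 0)
    [set c | f = fun a => \sum_(nu \in [set: intpart]) c nu * schur R nu a].

Definition omega (R : comNzRingType) (f : symser R) : symser R :=
  fun a => \sum_(nu \in [set: intpart])
    schur_coefs f nu * schur R (conj_part nu) a.

(* Main.v *)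
From HB Require Import structures.
Require Import Defs.
From mathcomp Require Import all_boot all_algebra.
From mathcomp Require Import boolp classical_sets functions cardinality fsbigop.
From mathcomp.multinomials Require Import freeg.
From mathcomp Require Import zify ring.

Set Implicit Arguments.
Unset Strict Implicit.
Unset Printing Implicit Defensive.
Import GRing.Theory.
Local Open Scope classical_set_scope.
Local Open Scope ring_scope.

(** Call [E_k] the coefficients of [A(x)] (or of [B(x)]) and [H_k] those of
    [Abar(x)] (or of [Bbar(x)]). The local relations between neighbouring factors
    make the [E_k] commute, and [Abar(x) A(-x) = 1], so that the [H_k] are the same
    polynomials in the [E_k] as the complete symmetric functions are in the
    elementary ones. At [beta = 0], acting on the empty partition, the [E_k] add
    horizontal strips and the [H_k] vertical strips; hence the coefficients of
    [E_a] and [H_a] on [nu] are those of the Schur functions of [nu] and of its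
    conjugate at [x^a]. As the [E_a] are symmetric in [a], also at [beta = 0], and
    as the Kostka numbers are unitriangular, there is a linear form [c] on the free
    module on partitions that maps [E_a] of the empty partition at [beta = 0] to
    the coefficient of [x^a] in the given function. It is the family of its Schur
    coefficients. Expressing [H] in terms of [E] shows that [c] maps [H_a] of the
    empty partition to the coefficient of [x^a] in the other function. *)

(** * Linear maps on free modules *)

(** In general $G$ and $J$ have unbounded degree, so infinitely many partitions can occur in the
    Schur expansion. This is why the coefficients are kept as a linear form and never as a vector: a
    word $E_a$ at [beta = 0] sends the empty partition to a finite combination, on which any form
    can be evaluated. The form is determined through words in the $E_k$ only. Hence the passage to
    $H$ goes through mixed words: the recursion expressing $H_k$ by $H_j$ with $j < k$ and the $E_i$
    is the same in every pair, and trades $H$ letters for $E$ letters until none remains. All that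
    depends on [beta] is condensed into the notion of [eh_pair]; the pair at [beta = 0] is the
    common model with which the pair of $A$ and that of $B$ are compared. *)

Section FreegLinear.
Context (R : comNzRingType) (K : choiceType) (M : lmodType R).
Implicit Types (v w : {freeg K / R}) (f : K -> M).

Lemma fglift_wide f v (s : seq K) : uniq s -> {subset dom v <= s} ->
  fglift f v = \sum_(x <- s) coeff x v *: f x.
Proof.
move=> us sub; rewrite -{1}[v]Freeg_dom fglift_Freeg /prelift big_map /=.
rewrite [RHS](bigID (mem (dom v))) /= [X in _ + X]big1; last first.
  by move=> x /coeff_outdom ->; rewrite scale0r.
rewrite addr0 -[RHS]big_filter; apply: perm_big.
apply: uniq_perm; rewrite ?uniq_dom ?filter_uniq// => x.
by rewrite mem_filter; case: (boolP (x \in dom v)) => // /sub ->.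
Qed.

Lemma fgliftE f v : fglift f v = \sum_(x <- dom v) coeff x v *: f x.
Proof. by apply: fglift_wide => //; exact: uniq_dom. Qed.

Lemma fglift_is_linear f : linear (fglift f).
Proof.
move=> a v w; pose s := undup (dom v ++ dom w ++ dom (a *: v + w)).
rewrite !(@fglift_wide _ _ s) ?undup_uniq // => [|x|x|x]; last 3 first.
- by rewrite mem_undup !mem_cat => ->; rewrite ?orbT.
- by rewrite mem_undup !mem_cat => ->; rewrite ?orbT.
- by rewrite mem_undup !mem_cat => ->; rewrite ?orbT.
rewrite scaler_sumr -big_split; apply: eq_bigr => x _ /=.
by rewrite coeffD coeffZ scalerDl scalerA.
Qed.

HB.instance Definition _ f :=
  GRing.isLinear.Build R {freeg K / R} M *:%R (fglift f) (fglift_is_linear f).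

Lemma fgliftU f x : fglift f << x >> = f x.
Proof. by rewrite liftU scale1r. Qed.

Lemma freegZU (a : R) (x : K) : << a *g x >> = a *: << x >> :> {freeg K / R}.
Proof. by apply/eqP/freeg_eqP => y; rewrite coeffZ !coeffU mul1r. Qed.

Lemma freeg_linear_eq (F G : {linear {freeg K / R} -> M}) :
  (forall x, F << x >> = G << x >>) -> F =1 G.
Proof.
move=> FG v; rewrite -[v]freeg_sumE !linear_sum; apply: eq_bigr => x _ /=.
by rewrite freegZU !linearZ_LR FG.
Qed.

End FreegLinear.

Ltac freeg_ring :=
  apply/eqP/freeg_eqP => ?; rewrite ?(coeffD, coeffN, coeffZ, coeff0); ring.

(** * Finite products of operator series *)

Section Products.
Context (R : comNzRingType).
Local Notation V := (RP R).
Local Notation op := {linear V -> V}.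
Implicit Types (t : op) (s : seq op) (k : nat) (v w : V).

(** The coefficient of $x^k$ in $(1 + x t_1) \cdots (1 + x t_n)$, where [s] lists $t_1, \ldots,
    t_n$: the head acts last. *)
Fixpoint els s k v : V :=
  if s is t :: s' then els s' k v + (if k is k'.+1 then t (els s' k' v) else 0)
  else @op1 R k v.

(** The coefficient of $x^k$ in $(1 - x t_n)^{-1} \cdots (1 - x t_1)^{-1}$: the head acts first,
    opposite to [els], so that this product and that of [els] at $-x$ cancel from the middle. *)
Fixpoint hls s k v : V :=
  if s is t :: s' then \sum_(j < k.+1) hls s' (k - j) (iter j t v)
  else @op1 R k v.

Lemma op1_is_linear k : linear (@op1 R k).
Proof. by case: k => [|k] a v w //=; rewrite scaler0 addr0. Qed.

Lemma iter_is_linear k t : linear (iter k t).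
Proof. by elim: k => [|k IH] a v w //=; rewrite IH linearP. Qed.

HB.instance Definition _ k t := GRing.isLinear.Build R V V *:%R (iter k t)
  (iter_is_linear k t).

Lemma els_is_linear s k : linear (els s k).
Proof.
elim: s k => [|t s IH] k a v w; first exact: op1_is_linear.
case: k => [|k] /=; first by rewrite !addr0 IH.
by rewrite !IH linearP scalerDr addrACA.
Qed.

HB.instance Definition _ s k := GRing.isLinear.Build R V V *:%R (els s k)
  (els_is_linear s k).

Lemma hls_is_linear s k : linear (hls s k).
Proof.
elim: s k => [|t s IH] k a v w; first exact: op1_is_linear.
rewrite /= scaler_sumr -big_split; apply: eq_bigr => j _.
by rewrite linearP IH.
Qed.

HB.instance Definition _ s k := GRing.isLinear.Build R V V *:%R (hls s k)
  (hls_is_linear s k).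

Lemma els0 s v : els s 0 v = v.
Proof. by elim: s => //= t s ->; rewrite addr0. Qed.

Lemma hls0 s v : hls s 0 v = v.
Proof. by elim: s v => //= t s IH v; rewrite big_ord1. Qed.

Lemma elsS t s k v : els (t :: s) k.+1 v = els s k.+1 v + t (els s k v).
Proof. by []. Qed.

Lemma hlsS t s k v :
  hls (t :: s) k.+1 v = hls s k.+1 v + hls (t :: s) k (t v).
Proof.
rewrite /= big_ord_recl subn0; congr (_ + _); apply: eq_bigr => i _.
by rewrite /= subSS -iterS iterSr.
Qed.

Lemma els_rcons s t k v : els (rcons s t) k v =
  els s k v + (if k is k'.+1 then els s k' (t v) else 0).
Proof.
elim: s k v => [|t0 s IH] [|k] v /=; rewrite ?addr0 //.
- by case: k => [|k] /=; rewrite ?linear0.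
- by rewrite IH addr0.
rewrite !IH linearD /=; case: k => [|k].
  by rewrite !addr0 !els0 linear0 addr0 addrAC.
by rewrite addrACA.
Qed.

Lemma hls_rconsS s t k v :
  hls (rcons s t) k.+1 v = hls s k.+1 v + t (hls (rcons s t) k v).
Proof.
elim: s k v => [|t0 s IH] k v.
  rewrite /= add0r linear_sum big_ord_recr /= subnn /=.
  rewrite big1 ?add0r; last by move=> i _; rewrite subSn ?leq_ord.
  rewrite big_ord_recr /= subnn big1 ?add0r // => i _.
  by rewrite -(subnSK (ltn_ord i)) linear0.
elim: k v => [|k IHk] v.
  rewrite rcons_cons !hlsS !IH !hls0.
  by rewrite addrAC.
rewrite rcons_cons hlsS IH -rcons_cons IHk addrACA -hlsS -linearD.
by rewrite rcons_cons -hlsS.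
Qed.

(** The two innermost factors cancel: expanding [els] at the head [t] and recombining the terms by
    [hlsS] removes [t] from both lists. *)
Lemma hls_els s k v :
  \sum_(i < k.+2) (-1) ^+ i *: hls s (k.+1 - i) (els s i v) = 0.
Proof.
elim: s => [|t s IH].
  apply: big1 => -[[|i] lti] _ /=; rewrite ?subn0 ?scaler0 //.
  by case: (_ - _)%N => [|?]; rewrite scaler0.
rewrite -[RHS]IH.
have -> : \sum_(i < k.+2) (-1) ^+ i *: hls (t :: s) (k.+1 - i) (els (t :: s) i v)
  = \sum_(i < k.+2) (-1) ^+ i *: hls (t :: s) (k.+1 - i) (els s i v)
  - \sum_(i < k.+1) (-1) ^+ i *: hls (t :: s) (k - i) (t (els s i v)).
  rewrite big_ord_recl [in RHS]big_ord_recl -!addrA; congr (_ + _).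
    by rewrite /= addr0.
  rewrite -sumrB; apply: eq_bigr => i _.
  rewrite lift0 elsS linearD scalerDr; congr (_ + _).
  by rewrite subSS exprS mulN1r scaleNr.
rewrite big_ord_recr [in RHS]big_ord_recr /= !subnn !big_ord1 addrAC /=.
rewrite -sumrB; congr (_ + _); apply: eq_bigr => i _.
rewrite -scalerBr subSn ?leq_ord //; congr (_ *: _).
by rewrite -![\sum_(_ < _) _]/(hls (t :: s) _ _) hlsS addrK.
Qed.

Definition commute_op t1 t2 := forall v, t1 (t2 v) = t2 (t1 v).

(** This says that $e_1 = t_1 + t_2$ and $e_2 = t_1 t_2$ of two noncommuting variables commute. It
    is the sum of the local plactic relations $t_1 t_2 t_1 = t_1 t_1 t_2$ and $t_1 t_2 t_2 = t_2 t_1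
    t_2$. *)
Definition knuth t1 t2 := forall v,
  t1 (t2 (t1 v)) + t1 (t2 (t2 v)) = t1 (t1 (t2 v)) + t2 (t1 (t2 v)).

Fixpoint commute_all t s : Prop :=
  if s is t' :: s' then commute_op t t' /\ commute_all t s' else True.

Fixpoint knuth_seq s : Prop :=
  if s is t :: s' then
    [/\ if s' is t' :: s'' then knuth t t' /\ commute_all t s'' else True
      & knuth_seq s']
  else True.

Lemma commute_all_els t s k v : commute_all t s ->
  t (els s k v) = els s k (t v).
Proof.
elim: s k v => [|t' s IH] k v /=; first by case: k; rewrite //= linear0.
move=> [tt' ts]; rewrite linearD IH //; congr (_ + _).
by case: k => [|k]; rewrite ?linear0 // tt' IH.
Qed.

(* The product of the coefficients [j] and [k] is rewritten, in [expand], so that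
   its symmetry in [j] and [k] is visible. *)
Lemma els_comm s j k v : knuth_seq s ->
  els s j (els s k v) = els s k (els s j v).
Proof.
elim: s j k v => [|t s IH] j k v; first by case: j; case: k.
case: j => [|j]; first by rewrite !els0.
case: k => [|k]; first by rewrite !els0.
case: s IH => [|t' s] IH.
  by case: j => [|j]; case: k => [|k]; rewrite /= ?(add0r, addr0, linear0).
move=> [[tt' ts] gs]; set s1 := t' :: s in IH gs *.
(* [key] moves [t] to the left of the coefficients of [s1]. As [t] commutes with the tail [s], only
   [t'] obstructs; [q] collects the commutator of [t'] and [t] and the square of [t], and the Knuth
   relation says exactly that $q t' = t t' t$. *)
pose q w := t' (t w) - t (t' w) + t (t w).
have key i w : els s1 i.+1 (t w) + t (els s1 i (t w))
             = t (els s1 i.+1 w) + q (els s1 i w).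
  rewrite /s1 /= -!commute_all_els //.
  case: i => [|i].
    rewrite /= !addr0 !els0 /q linearD /=.
    freeg_ring.
  rewrite -!commute_all_els //.
  set a := els s i.+2 w; set b := els s i.+1 w; set c := els s i w.
  have := tt' c; rewrite /q !linearD.
  move=> /(canRL (addrK _)) ->.
  freeg_ring.
have {}IH := fun j k v => IH j k v gs; clearbody s1.
have expand i l : els (t :: s1) i.+1 (els (t :: s1) l.+1 v) =
    els s1 i.+1 (els s1 l.+1 v) + t (els s1 i (els s1 l.+1 v))
    + (t (els s1 i.+1 (els s1 l v)) + q (els s1 i (els s1 l v))).
  rewrite -key (elsS t s1 i) (elsS t s1 l) !linearD.
  by rewrite addrACA.
rewrite !expand (IH j.+1) (IH j k) (IH j.+1 k) (IH k.+1 j).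
by rewrite -!addrA; congr (_ + _); rewrite addrCA.
Qed.

End Products.

(** * Infinite products *)

Definition eventually (P : nat -> Prop) := exists N, forall n, (N <= n)%N -> P n.

Lemma eventuallyT (P : nat -> Prop) : (forall n, P n) -> eventually P.
Proof. by move=> H; exists 0%N. Qed.

Lemma eventually_and (P Q : nat -> Prop) :
  eventually P -> eventually Q -> eventually (fun n => P n /\ Q n).
Proof.
move=> [M PM] [N QN]; exists (maxn M N) => n; rewrite geq_max => /andP[Mn Nn].
by split; [exact: PM|exact: QN].
Qed.

Lemma eventually_imp (P Q : nat -> Prop) :
  (forall n, P n -> Q n) -> eventually P -> eventually Q.
Proof. by move=> PQ [N PN]; exists N => n /PN /PQ. Qed.

Lemma eventually_all (P : nat -> nat -> Prop) m :
  (forall i, (i < m)%N -> eventually (P i)) ->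
  eventually (fun n => forall i, (i < m)%N -> P i n).
Proof.
elim: m => [|m IH] H; first exact: eventuallyT.
have := eventually_and (IH (fun i lt => H i (leqW lt))) (H m (ltnSn m)).
apply: eventually_imp => n [Pn Pm] i; rewrite ltnS leq_eqVlt.
by case/orP => [/eqP->|/Pn].
Qed.

Lemma eventually_const (P : Prop) : eventually (fun _ => P) -> P.
Proof. by case=> N /(_ N (leqnn N)). Qed.

(* Modelled on [E k], [H k] being the multiplications by the elementary and by the
   complete symmetric function of degree [k]. *)
Record eh_pair (R : comNzRingType) (E H : opser R) : Prop := EHPair {
  eh_linE : forall k, linear (E k);
  eh_linH : forall k, linear (H k);
  eh_E0 : forall v, E 0%N v = v;
  eh_H0 : forall v, H 0%N v = v;
  eh_comm : forall j k v, E j (E k v) = E k (E j v);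
  eh_inv : forall k v, \sum_(i < k.+2) (-1) ^+ i *: H (k.+1 - i)%N (E i v) = 0
}.

Section Limits.
Context (R : comNzRingType).
Local Notation V := (RP R).
Local Notation op := {linear V -> V}.
Implicit Types (k : nat) (v w : V) (P : nat -> opser R) (T : opser R).

Definition converges P T := forall k v, eventually (fun n => P n k v = T k v).

Lemma oplim_converges P :
  (forall k v, eventually (fun n => P n.+1 k v = P n k v)) ->
  converges P (oplim P).
Proof.
move=> stab k v; rewrite /oplim /stable_value.
case: (stab k v) => N stN; apply: (@xgetPex _ 0 [set x | exists M, forall n,
  (M <= n)%N -> P n k v = x]).
exists (P N k v), N; elim=> [|n IH]; first by rewrite leqn0 => /eqP->.
by rewrite leq_eqVlt => /orP[/eqP->//|]; rewrite ltnS => Nn; rewrite stN ?IH.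
Qed.

(** Each law involves finitely many coefficients at finitely many vectors, so it is inherited from
    the finite product at one [n] where all of them have stabilised. *)
Lemma converges_eh_pair (s : nat -> seq op) E H : (forall n, knuth_seq (s n)) ->
  converges (fun n => els (s n)) E -> converges (fun n => hls (s n)) H ->
  eh_pair E H.
Proof.
move=> ks cE cH; split.
- move=> k a v w; apply: eventually_const.
  have := eventually_and (cE k (a *: v + w)) (eventually_and (cE k v) (cE k w)).
  by apply: eventually_imp => n [<- [<- <-]]; rewrite linearP.
- move=> k a v w; apply: eventually_const.
  have := eventually_and (cH k (a *: v + w)) (eventually_and (cH k v) (cH k w)).
  by apply: eventually_imp => n [<- [<- <-]]; rewrite linearP.
- move=> v; apply: eventually_const; move: (cE 0%N v).
  by apply: eventually_imp => n <-; rewrite els0.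
- move=> v; apply: eventually_const; move: (cH 0%N v).
  by apply: eventually_imp => n <-; rewrite hls0.
- move=> j k v; apply: eventually_const.
  have := eventually_and (eventually_and (cE j v) (cE k v))
            (eventually_and (cE j (E k v)) (cE k (E j v))).
  by apply: eventually_imp => n [[Ej Ek] [<- <-]]; rewrite -Ej -Ek els_comm.
- move=> k v; apply: eventually_const.
  have cEi : eventually (fun n => forall i, (i < k.+2)%N ->
      els (s n) i v = E i v /\ hls (s n) (k.+1 - i) (E i v) = H (k.+1 - i)%N (E i v)).
    by apply: eventually_all => i _; apply: eventually_and.
  move: cEi; apply: eventually_imp => n cn.
  rewrite -[RHS](hls_els (s n) k v); apply: eq_bigr => i _.
  by have [<- <-] := cn i (ltn_ord i).
Qed.

Lemma opmulD1l (t : op) T k v : opmul (opD1 t) T k v =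
  T k v + (if k is k'.+1 then t (T k' v) else 0).
Proof.
rewrite /opmul big_ord_recl subn0; congr (_ + _).
case: k => [|k]; first by rewrite big_ord0.
by rewrite big_ord_recl /= subSS subn0 big1 ?addr0.
Qed.

Lemma opmulD1r (t : op) T k v : (forall k, T k 0 = 0) ->
  opmul T (opD1 t) k v = T k v + (if k is k'.+1 then T k' (t v) else 0).
Proof.
move=> T0; rewrite /opmul big_ord_recr /= subnn addrC; congr (_ + _).
case: k => [|k]; first by rewrite big_ord0.
rewrite big_ord_recr /= subSn // subnn /= big1 ?add0r // => i _.
by rewrite subSn ?subnSK //; [rewrite -(subnSK (ltn_ord i)) T0|exact: ltnW].
Qed.

Lemma oprodl_els (t : nat -> op) N k v :
  oprodl (fun i => opD1 (t i)) N k v = els (rev (mkseq t N)) k v.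
Proof.
elim: N k => [|N IH] k //; rewrite mkseqS rev_rcons.
rewrite [LHS](opmulD1l (t N) (oprodl (fun i => opD1 (t i)) N)) /= IH.
by case: k => // k; rewrite IH.
Qed.

Lemma oprodr_els (t : nat -> op) N k v :
  oprodr (fun i => opD1 (t i)) N k v = els (mkseq t N) k v.
Proof.
elim: N k v => [|N IH] k v //; 
rewrite [LHS](@opmulD1r (t N) (oprodr (fun i => opD1 (t i)) N)) => [|j]; last first.
  by rewrite IH linear0.
by rewrite mkseqS els_rcons IH; case: k => // k; rewrite IH.
Qed.

Lemma oprodr_hls (t : nat -> op) N k v :
  oprodr (fun i => opgeom (t i)) N k v = hls (rev (mkseq t N)) k v.
Proof.
elim: N k v => [|N IH] k v //; rewrite mkseqS rev_rcons /= /opmul.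
rewrite (reindex_inj rev_ord_inj) /=; apply: eq_bigr => j _.
by rewrite IH subSS /opgeom subKn // -ltnS.
Qed.

Lemma opmul_geomlS (t : op) T k v :
  opmul (opgeom t) T k.+1 v = T k.+1 v + t (opmul (opgeom t) T k v).
Proof.
rewrite /opmul big_ord_recl subn0 /= linear_sum; congr (_ + _).
Qed.

Lemma oprodl_hls (t : nat -> op) N k v :
  oprodl (fun i => opgeom (t i)) N k v = hls (mkseq t N) k v.
Proof.
elim: N k v => [|N IH] k v //; rewrite mkseqS.
elim: k => [|k IHk]; first by rewrite hls0 /= /opmul big_ord1 /opgeom /= IH hls0.
rewrite [LHS](opmul_geomlS (t N) (oprodl (fun i => opgeom (t i)) N)).
by rewrite IH hls_rconsS -IHk.
Qed.

(* [t i] plays the role of an operator on column [i]. *)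
Record column_ops (t : nat -> op) : Prop := ColumnOps {
  column_far : forall i j, (i.+1 < j)%N -> commute_op (t i) (t j);
  column_finite : forall v, exists m, forall i, (m < i)%N -> t i v = 0
}.

Section Column.
Variables (t : nat -> op) (ct : column_ops t).

Definition vanishes_above m v := forall i, (m < i)%N -> t i v = 0.

Lemma vanishes_aboveD m v w :
  vanishes_above m v -> vanishes_above m w -> vanishes_above m (v + w).
Proof. by move=> mv mw i mi; rewrite linearD mv // mw // addr0. Qed.

(** Either $j > m$ and $t_j v = 0$, or [i] and [j] are far apart and the operators commute. The
    bound grows by one per operator, hence by [k] in a coefficient of degree [k]. *)
Lemma vanishes_above_op m v j :
  vanishes_above m v -> vanishes_above m.+1 (t j v).
Proof.
move=> mv i mi; have [mj|jm] := ltnP m j; first by rewrite mv // linear0.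
have ji : (j.+1 < i)%N by apply: leq_ltn_trans mi; rewrite ltnS.
by rewrite -(column_far ct ji) mv ?linear0 //; apply: ltn_trans mi.
Qed.

Lemma vanishes_above_els m v N k : vanishes_above m v ->
  vanishes_above (m + k) (els (rev (mkseq t N)) k v).
Proof.
move=> mv; elim: N k => [|N IH] k.
  by case: k => [|k]; rewrite ?addn0 // => i _; rewrite linear0.
rewrite mkseqS rev_rcons; case: k => [|k]; first by rewrite els0 addn0.
rewrite elsS; apply: vanishes_aboveD; first exact: IH.
by rewrite addnS; apply: vanishes_above_op; exact: IH.
Qed.

Lemma vanishes_above_hls m v N k : vanishes_above m v ->
  vanishes_above (m + k) (hls (mkseq t N) k v).
Proof.
move=> mv; elim: N k => [|N IHN] k.
  by case: k => [|k]; rewrite ?addn0 // => i _; rewrite linear0.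
elim: k => [|k IHk]; first by rewrite hls0 addn0.
rewrite mkseqS hls_rconsS; apply: vanishes_aboveD; first exact: IHN.
by rewrite addnS; apply: vanishes_above_op; rewrite -mkseqS.
Qed.

(** The new factor acts last, on a vector already changed by up to [k] operators, whence the bound
    [m + k]; in [els_stable] it acts first, on [v] itself. *)
Lemma els_rev_stable k v :
  eventually (fun n => els (rev (mkseq t n.+1)) k v = els (rev (mkseq t n)) k v).
Proof.
case: (column_finite ct v) => m mv; exists (m + k).+1 => n mn.
rewrite mkseqS rev_rcons; case: k mn => [|k] mn; first by rewrite !els0.
rewrite elsS (@vanishes_above_els m v n k mv) ?addr0 //.
by apply: ltn_trans mn; rewrite addnS.
Qed.

Lemma els_stable k v :
  eventually (fun n => els (mkseq t n.+1) k v = els (mkseq t n) k v).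
Proof.
case: (column_finite ct v) => m mv; exists m.+1 => n mn.
rewrite mkseqS els_rcons; case: k => [|k]; first by rewrite addr0.
by rewrite mv // linear0 addr0.
Qed.

Lemma hls_rev_stable k v :
  eventually (fun n => hls (rev (mkseq t n.+1)) k v = hls (rev (mkseq t n)) k v).
Proof.
case: (column_finite ct v) => m mv; exists m.+1 => n mn.
rewrite mkseqS rev_rcons; case: k => [|k]; first by rewrite !hls0.
by rewrite hlsS mv // linear0 addr0.
Qed.

Lemma hls_stable k v :
  eventually (fun n => hls (mkseq t n.+1) k v = hls (mkseq t n) k v).
Proof.
case: (column_finite ct v) => m mv; exists (m + k).+1 => n mn.
case: k mn => [|k] mn; first by rewrite !hls0.
rewrite mkseqS hls_rconsS -mkseqS (@vanishes_above_hls m v n.+1 k mv) ?addr0 //.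
by apply: ltn_trans mn; rewrite addnS.
Qed.

Lemma commute_all_map_iota i m n : (i.+1 < m)%N ->
  commute_all (t i) (map t (iota m n)).
Proof.
elim: n m => //= n IH m im; split; first exact: (column_far ct).
by apply: IH; apply: ltnW.
Qed.

Lemma commute_all_rev_mkseq i m : (m < i)%N ->
  commute_all (t i) (rev (mkseq t m)).
Proof.
elim: m => // m IH mi; rewrite mkseqS rev_rcons; split; last exact/IH/ltnW.
by move=> v; rewrite (column_far ct mi).
Qed.

Lemma oprodlD1_converges : converges (fun n => els (rev (mkseq t n)))
  (oplim (oprodl (fun i => opD1 (t i)))).
Proof.
move=> k v; have /oplim_converges/(_ k v) : forall k v, eventually (fun n =>
    oprodl (fun i => opD1 (t i)) n.+1 k v = oprodl (fun i => opD1 (t i)) n k v).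
  move=> j w; move: (els_rev_stable j w).
  by apply: eventually_imp => n; rewrite !oprodl_els.
by apply: eventually_imp => n; rewrite oprodl_els.
Qed.

Lemma oprodr_geom_converges : converges (fun n => hls (rev (mkseq t n)))
  (oplim (oprodr (fun i => opgeom (t i)))).
Proof.
move=> k v; have /oplim_converges/(_ k v) : forall k v, eventually (fun n =>
    oprodr (fun i => opgeom (t i)) n.+1 k v = oprodr (fun i => opgeom (t i)) n k v).
  move=> j w; move: (hls_rev_stable j w).
  by apply: eventually_imp => n; rewrite !oprodr_hls.
by apply: eventually_imp => n; rewrite oprodr_hls.
Qed.

Lemma oprodrD1_converges : converges (fun n => els (mkseq t n))
  (oplim (oprodr (fun i => opD1 (t i)))).
Proof.
move=> k v; have /oplim_converges/(_ k v) : forall k v, eventually (fun n =>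
    oprodr (fun i => opD1 (t i)) n.+1 k v = oprodr (fun i => opD1 (t i)) n k v).
  move=> j w; move: (els_stable j w).
  by apply: eventually_imp => n; rewrite !oprodr_els.
by apply: eventually_imp => n; rewrite oprodr_els.
Qed.

Lemma oprodl_geom_converges : converges (fun n => hls (mkseq t n))
  (oplim (oprodl (fun i => opgeom (t i)))).
Proof.
move=> k v; have /oplim_converges/(_ k v) : forall k v, eventually (fun n =>
    oprodl (fun i => opgeom (t i)) n.+1 k v = oprodl (fun i => opgeom (t i)) n k v).
  move=> j w; move: (hls_stable j w).
  by apply: eventually_imp => n; rewrite !oprodl_hls.
by apply: eventually_imp => n; rewrite oprodl_hls.
Qed.

Lemma oprodl_eh_pair : (forall i, knuth (t i.+1) (t i)) ->
  eh_pair (oplim (oprodl (fun i => opD1 (t i))))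
          (oplim (oprodr (fun i => opgeom (t i)))).
Proof.
move=> kt; apply: converges_eh_pair oprodlD1_converges oprodr_geom_converges.
elim=> [|[|n] IH] //; rewrite mkseqS rev_rcons; split => //.
rewrite mkseqS rev_rcons; split; first exact: kt.
exact: commute_all_rev_mkseq.
Qed.

Lemma oprodr_eh_pair : (forall i, knuth (t i) (t i.+1)) ->
  eh_pair (oplim (oprodr (fun i => opD1 (t i))))
          (oplim (oprodl (fun i => opgeom (t i)))).
Proof.
move=> kt; apply: converges_eh_pair oprodrD1_converges oprodl_geom_converges.
move=> n; rewrite /mkseq; elim: n {1}0%N => //= n IH m; split; last exact: IH.
case: n IH => //= n _; split; first exact: kt.
exact: commute_all_map_iota.
Qed.

End Column.

End Limits.

(** * Partitions and their columns *)

Lemma ltn_ext m n : (forall r, (r < m)%N = (r < n)%N) -> m = n.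
Proof.
move=> H; apply/eqP; rewrite eqn_leq; apply/andP.
by split; rewrite leqNgt; [rewrite H|rewrite -H]; rewrite ltnn.
Qed.

Section Partitions.
Implicit Types (la mu nu : intpart) (f g : nat -> nat).

Definition row la r := nth 0%N (val la) r.

Lemma count_ltn_sorted (s : seq nat) r j : sorted geq s ->
  (r < count (ltn j) s)%N = (j < nth 0 s r)%N.
Proof.
elim: s r => [|x s IH] r /=; first by rewrite nth_nil ltn0.
move=> pxs; have srt := path_sorted pxs.
have [jx|xj] := ltnP j x; first by case: r => [|r] //=; rewrite add1n ltnS IH.
have ale : all (geq x) s by apply: order_path_min pxs => a b c /= ba cb; lia.
have small i : (nth 0 s i <= j)%N.
  have [lti|gei] := ltnP i (size s); last by rewrite nth_default.
  by apply: leq_trans xj; apply: (all_nthP 0%N ale).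
rewrite add0n IH //; case: r => [|r] /=; first by rewrite !ltnNge small xj.
by rewrite !ltnNge !small.
Qed.

Lemma ltn_collen la r j : (r < collen la j)%N = (j < row la r)%N.
Proof. by apply: count_ltn_sorted; case/andP: (valP la). Qed.

Lemma row_eq0 la r : (row la r == 0%N) = (size (val la) <= r)%N.
Proof.
have [lt|ge] := ltnP r (size (val la)); last by rewrite /row nth_default.
case/andP: (valP la) => _ /negP n0; apply/negP => /eqP e.
by apply: n0; rewrite -e mem_nth.
Qed.

Lemma row_inj la mu : row la =1 row mu -> la = mu.
Proof.
move=> e; apply: val_inj; apply: (@eq_from_nth _ 0%N) => [|i _]; last exact: e.
by apply: ltn_ext => r; rewrite !ltnNge -!row_eq0 e.
Qed.

Lemma row_nonincr la r : (row la r.+1 <= row la r)%N.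
Proof.
rewrite leqNgt; apply/negP; rewrite -ltn_collen => /ltnW.
by rewrite ltn_collen ltnn.
Qed.

Lemma collen_nonincr la j : (collen la j.+1 <= collen la j)%N.
Proof. by apply: sub_count => r /=; apply: ltnW. Qed.

Lemma row_conj la j : row (conj_part la) j = collen la j.
Proof.
rewrite /row /= /conj_seq; have [lt|ge] := ltnP j (head 0%N (val la)).
  by rewrite nth_mkseq.
rewrite nth_default ?size_mkseq //; apply/esym/eqP.
by rewrite -leqn0 leqNgt ltn_collen /row nth0 -leqNgt.
Qed.

Lemma collen_conj la r : collen (conj_part la) r = row la r.
Proof. by apply: ltn_ext => j; rewrite ltn_collen row_conj ltn_collen. Qed.

Lemma conj_partK : involutive conj_part.
Proof. by move=> la; apply: row_inj => r; rewrite row_conj collen_conj. Qed.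

Lemma collen_inj la mu : collen la =1 collen mu -> la = mu.
Proof.
by move=> e; apply/(can_inj conj_partK)/row_inj => r; rewrite !row_conj e.
Qed.

(** One zero suffices: by monotonicity all later values vanish too. *)
Definition cols f := (forall j, (f j.+1 <= f j)%N) /\ exists m, f m = 0%N.

Lemma cols_leq f i j : cols f -> (i <= j)%N -> (f j <= f i)%N.
Proof.
move=> [mono _]; elim: j => [|j IH]; first by rewrite leqn0 => /eqP->.
rewrite leq_eqVlt => /orP[/eqP->//|/IH]; exact: leq_trans.
Qed.

Lemma cols_collen la : cols (collen la).
Proof.
split=> [j|]; first exact: collen_nonincr.
by exists (row la 0); apply/eqP; rewrite -leqn0 leqNgt ltn_collen ltnn.
Qed.

Lemma cols_rows f : cols f -> exists la, row la =1 f.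
Proof.
move=> cf; have [_ [m0 fm0]] := cf.
have ex0 : exists m, f m == 0%N by exists m0; apply/eqP.
case: (ex_minnP ex0) => m /eqP fm mmin.
have ps : is_part (mkseq f m).
  apply/andP; split.
    by apply: (homo_sorted _ _ (iota_sorted 0 _)) => i j /=; exact: cols_leq.
  apply/negP => /mapP[i]; rewrite mem_iota add0n => /andP[_ im] /esym/eqP/mmin.
  by rewrite leqNgt im.
exists (exist (fun s => is_part s) _ ps) => r; rewrite /row /=; have [lt|ge] := ltnP r m.
  by rewrite nth_mkseq.
rewrite nth_default ?size_mkseq //; apply/esym/eqP.
by rewrite -leqn0 -fm cols_leq.
Qed.

Lemma cols_part f : cols f -> exists la, collen la =1 f.
Proof.
move=> /cols_rows[la laf]; exists (conj_part la) => j.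
by rewrite collen_conj.
Qed.

Lemma cols_sub_bounded f g j : cols f -> (forall k, (g k.+1 <= g k)%N) ->
  (forall k, (j < k)%N -> (g k <= f k)%N) -> cols g.
Proof.
move=> cf mg gf; split=> //; case: cf => mono [m fm]; exists (maxn m j.+1).
apply/eqP; rewrite -leqn0; apply: leq_trans (gf _ _) _.
  by rewrite leq_max leqnn orbT.
by rewrite -fm cols_leq ?leq_maxl //; split => //; exists m.
Qed.

End Partitions.

(** * Adding and removing boxes in terms of column lengths *)

Section ColumnVectors.
Context (R : comNzRingType).
Local Notation V := (RP R).
Implicit Types (f g : nat -> nat) (la mu : intpart) (i j : nat).

Lemma up_is_linear i : linear (@up R i).
Proof. exact: fglift_is_linear. Qed.

HB.instance Definition _ i :=
  GRing.isLinear.Build R V V *:%R (@up R i) (up_is_linear i).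

Lemma dn_is_linear i : linear (@dn R i).
Proof. exact: fglift_is_linear. Qed.

HB.instance Definition _ i :=
  GRing.isLinear.Build R V V *:%R (@dn R i) (dn_is_linear i).

(* The partition with column lengths [f], or [0] if there is none. *)
Definition cw f : V :=
  \sum_(mu \in [set mu | forall k, collen mu k = f k]) pbasis R mu.

Lemma cw_collen la : cw (collen la) = pbasis R la.
Proof.
rewrite /cw [X in finite_support _ X _](_ : _ = [set la]) ?fsbig_set1 //.
by apply/seteqP; split => mu /= => [/collen_inj|->].
Qed.

Lemma cw_eq0 f j : (f j < f j.+1)%N -> cw f = 0.
Proof.
move=> fj; rewrite /cw [X in finite_support _ X _](_ : _ = set0) ?fsbig_set0 //.
apply/seteqP; split => mu //= e.
by have := collen_nonincr mu j; rewrite !e leqNgt fj.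
Qed.

Lemma cw_cols f : cols f -> exists2 la, cw f = pbasis R la & collen la =1 f.
Proof.
move=> /cols_part[la laf]; exists la => //.
by rewrite -cw_collen; congr cw; apply/esym/funext.
Qed.

Lemma eq_cw f g : f =1 g -> cw f = cw g.
Proof. by move=> /funext->. Qed.

(** If the box does not fit, the right side is 0 by the convention in [cw]. In [dn_cw] an explicit
    test is made, because truncated subtraction leaves an empty column unchanged. *)
Lemma up_cw i f : cols f -> up i (cw f) = cw (fun k => f k + (k == i))%N.
Proof.
move=> /cw_cols[la -> laf]; rewrite /up fgliftU /cw /adds_box.
by congr (\sum_(_ \in _) _); apply/seteqP; split => mu /= e k; rewrite e laf.
Qed.

Lemma dn_cw i f : cols f ->
  dn i (cw f) = if (f i.+1 < f i)%N then cw (fun k => f k - (k == i))%N else 0.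
Proof.
move=> /cw_cols[la -> laf]; rewrite /dn fgliftU /cw /adds_box.
case: ltnP => fi.
  congr (\sum_(_ \in _) _); apply/seteqP; split => mu /= e k.
    by rewrite -laf e addnK.
  by rewrite laf e subnK //; case: eqP => // ->; lia.
rewrite [X in finite_support _ X _](_ : _ = set0) ?fsbig_set0 //.
apply/seteqP; split => mu //= e; move: fi; rewrite -!laf !e eqxx.
have := collen_nonincr mu i; lia.
Qed.

Lemma cols_dn i f : cols f -> (f i.+1 < f i)%N ->
  cols (fun k => f k - (k == i))%N.
Proof.
move=> cf fi; apply: (@cols_sub_bounded _ _ 0 cf) => [k|k _]; last exact: leq_subr.
by case: cf => /(_ k) mono _; case: (k =P i) => [->|]; lia.
Qed.

Lemma cols_up i f : cols f -> ((0 < i)%N -> (f i < f i.-1)%N) ->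
  cols (fun k => f k + (k == i))%N.
Proof.
move=> cf fi; apply: (@cols_sub_bounded _ _ i cf) => [k|k ik].
  case: cf => /(_ k) fk _; case: (k.+1 =P i) fi => [<-/=|]; lia.
by rewrite (_ : (k == i) = false) ?addn0 //; lia.
Qed.

Lemma cw_linear_eq (F G : {linear V -> V}) :
  (forall f, cols f -> F (cw f) = G (cw f)) -> F =1 G.
Proof.
move=> FG; apply: freeg_linear_eq => la.
by have := FG _ (cols_collen la); rewrite cw_collen.
Qed.

Lemma upupC i j : (i.+1 < j)%N -> commute_op (@up R i) (@up R j).
Proof.
case: j => // j ij; apply: (@cw_linear_eq (@up R i \o @up R j.+1) (@up R j.+1 \o @up R i)).
move=> f cf /=; rewrite !(up_cw _ cf).
(* A box always fits in column 0; the bound [(f i).+1] makes the test succeed there. *)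
have [fi|fi] := ltnP (f i) (if i is i'.+1 then f i' else (f i).+1).
  have ci : cols (fun k => f k + (k == i))%N.
    by apply: cols_up => //; case: i fi {ij}.
  have [fj|fj] := ltnP (f j.+1) (f j).
    have cj : cols (fun k => f k + (k == j.+1))%N by apply: cols_up.
    by rewrite !up_cw //; apply: eq_cw => k; rewrite addnAC.
  rewrite (up_cw _ ci) [cw (fun k => f k + (k == j.+1))%N](@cw_eq0 _ j) ?linear0.
    by rewrite (@cw_eq0 _ j) //; lia.
  by lia.
case: i fi ij => [|i] fi ij; first by lia.
rewrite [cw (fun k => f k + (k == i.+1))%N](@cw_eq0 _ i) ?linear0; last by lia.
have [fj|fj] := ltnP (f j.+1) (f j).
  have cj : cols (fun k => f k + (k == j.+1))%N by apply: cols_up.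
  by rewrite (up_cw _ cj) (@cw_eq0 _ i) //; lia.
by rewrite [cw (fun k => f k + (k == j.+1))%N](@cw_eq0 _ j) ?linear0 //; lia.
Qed.

Lemma dndnC i j : (i.+1 < j)%N -> commute_op (@dn R i) (@dn R j).
Proof.
move=> ij; apply: (@cw_linear_eq (@dn R i \o @dn R j) (@dn R j \o @dn R i)).
move=> f cf /=; rewrite !(dn_cw _ cf).
have e1 : (j == i) = false by lia.
have e2 : (j.+1 == i) = false by lia.
have e3 : (i == j) = false by lia.
have e4 : (i.+1 == j) = false by lia.
case: (ltnP (f j.+1) (f j)) => fj; case: (ltnP (f i.+1) (f i)) => fi;
  rewrite ?linear0 // !dn_cw; try exact: cols_dn.
- rewrite e1 e2 e3 e4 !subn0 fi fj.
  by apply: eq_cw => k; rewrite subnAC.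
- by rewrite e3 e4 !subn0 ltnNge fi.
- by rewrite e1 e2 !subn0 ltnNge fj.
Qed.

Lemma updnC i j : (i.+1 < j)%N || (j.+1 < i)%N ->
  commute_op (@up R i) (@dn R j).
Proof.
move=> ij; apply: (@cw_linear_eq (@up R i \o @dn R j) (@dn R j \o @up R i)).
move=> f cf /=; rewrite (up_cw _ cf) (dn_cw _ cf).
have e1 : (j == i) = false by lia.
have e2 : (j.+1 == i) = false by lia.
have [fi|fi] := ltnP (f i) (if i is i'.+1 then f i' else (f i).+1).
  have ci : cols (fun k => f k + (k == i))%N.
    by apply: cols_up => //; case: i fi {ij e1 e2}.
  rewrite dn_cw // e1 e2 !addn0; case: ltnP => fj; last by rewrite linear0.
  rewrite up_cw; last exact: cols_dn.
  by apply: eq_cw => k; case: (k =P i) => [->|]; lia.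
case: i fi ij e1 e2 => [|i] fi ij e1 e2; first by lia.
rewrite [cw (fun k => f k + (k == i.+1))%N](@cw_eq0 _ i) ?linear0; last by lia.
case: ltnP => fj; last by rewrite linear0.
rewrite up_cw; last exact: cols_dn.
by rewrite (@cw_eq0 _ i) //; lia.
Qed.

End ColumnVectors.

(** * Local relations *)

Section UpTilde.
Context (R : comNzRingType) (beta : R).
Local Notation V := (RP R).
Local Notation cw := (@cw R).
Implicit Types (f g : nat -> nat) (la mu : intpart) (i j : nat).

Lemma uptE i v : upt beta i v = up i v - beta *: up i (dn i v).
Proof. by rewrite /upt linearB linearZ_LR. Qed.

Lemma upt_is_linear i : linear (upt beta i).
Proof. by move=> a v w; rewrite !uptE !linearP; freeg_ring. Qed.

HB.instance Definition _ i :=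
  GRing.isLinear.Build R V V *:%R (upt beta i) (upt_is_linear i).

(** After a successful [dn i], [up i] restores the partition, so $u_i d_i$ is the projection onto
    the partitions with a removable box in column [i]. *)
Lemma upt_cw i f : cols f -> upt beta i (cw f) =
  cw (fun k => f k + (k == i))%N - (if (f i.+1 < f i)%N then beta *: cw f else 0).
Proof.
move=> cf; rewrite uptE (up_cw _ _ cf) (dn_cw _ _ cf).
case: ltnP => fi; last by rewrite linear0 scaler0.
rewrite (up_cw _ _ (cols_dn cf fi)); congr (_ - _ *: _); apply: eq_cw => k.
by case: (k =P i) => [->|]; lia.
Qed.

Lemma upt_far i j : (i.+1 < j)%N -> commute_op (upt beta i) (upt beta j).
Proof.
move=> ij v; have ij' : (i.+1 < j)%N || (j.+1 < i)%N by rewrite ij.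
have ji' : (j.+1 < i)%N || (i.+1 < j)%N by rewrite ij orbT.
have dd (x : V) : dn j (dn i x) = dn i (dn j x) by rewrite (dndnC ij x).
have ud (x : V) : dn j (up i x) = up i (dn j x) by rewrite (updnC ij' x).
have du (x : V) : up j (dn i x) = dn i (up j x) by rewrite (updnC ji' x).
have uu (x : V) : up j (up i x) = up i (up j x) by rewrite (upupC ij x).
rewrite /= !uptE !linearB !linearZ_LR /= !(ud, dd) !(uu, du).
by freeg_ring.
Qed.

Lemma upt_finite v : exists m, forall i, (m < i)%N -> upt beta i v = 0.
Proof.
elim/freeg_ind_dom0: v => [|a la v _ _ [m mv]].
  by exists 0%N => i _; rewrite linear0.
exists (maxn m (row la 0)) => i; rewrite gtn_max => /andP[mi lai].
rewrite freegZU linearP /= mv // addr0 -[<< la >>]cw_collen upt_cw; last first.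
  exact: cols_collen.
have z j : (row la 0 <= j)%N -> collen la j = 0%N.
  by move=> ge; apply/eqP; rewrite -leqn0 leqNgt ltn_collen -leqNgt.
rewrite (z i.+1) ?(z i) ?ltnn ?subr0 ?(ltnW lai) //; last by rewrite ltnW // ltnW.
case: i mi lai => // i mi lai; rewrite (@cw_eq0 _ _ i) ?scaler0 //.
by rewrite !z // ?(ltnW lai) // eqxx; lia.
Qed.

(* [F p q] stands for a partition with [p] boxes added to a column of length [b]
   and [q] boxes added to the next column, of length [c]. *)
Lemma local_knuth (X Y : {linear V -> V}) (F : nat -> nat -> V) b c d :
  (c <= b)%N -> (d <= c)%N ->
  (forall p q, (b + p < c + q)%N -> F p q = 0) ->
  (forall p q, (c + q <= b + p)%N -> X (F p q) =
     F p.+1 q - (if (c + q < b + p)%N then beta *: F p q else 0)) ->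
  (forall p q, (c + q <= b + p)%N -> Y (F p q) =
     F p q.+1 - (if (d < c + q)%N then beta *: F p q else 0)) ->
  Y (X (Y (F 0 0))) + Y (X (X (F 0 0))) = Y (Y (X (F 0 0))) + X (Y (X (F 0 0))).
Proof.
move=> cb dc F0 XE YE.
have XT p q : (c + q < b + p)%N -> X (F p q) = F p.+1 q - beta *: F p q.
  by move=> lt; rewrite XE ?lt // ltnW.
have XF p q : (c + q = b + p)%N -> X (F p q) = F p.+1 q.
  by move=> e; rewrite XE ?e ?ltnn ?subr0.
have YT p q : (c + q <= b + p)%N -> (d < c + q)%N ->
    Y (F p q) = F p q.+1 - beta *: F p q by move=> ? lt; rewrite YE ?lt.
have YF p q : (c + q <= b + p)%N -> (c + q = d)%N -> Y (F p q) = F p q.+1.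
  by move=> ? e; rewrite YE // e ltnn subr0.
clear XE YE.
(* Words of length three in [X] and [Y] see the gap $b - c$ only up to 2, and of the next column
   only whether it is shorter than [c]. *)
have [bc|[bc|bc]] : b = c \/ b = c.+1 \/ (c.+2 <= b)%N by lia.
- have E := (XF 0 0 ltac:(lia), XT 1 0 ltac:(lia), XF 1 1 ltac:(lia),
    YT 1 1 ltac:(lia) ltac:(lia), F0 0 1 ltac:(lia),
    F0 1 2 ltac:(lia)).
  case: (ltnP d c) => e.
  + have E' := (YT 0 0 ltac:(lia) ltac:(lia), YT 1 0 ltac:(lia) ltac:(lia),
      YT 2 0 ltac:(lia) ltac:(lia)).
    by rewrite !(E, E', linearB X, linearB Y, linearZ_LR X, linearZ_LR Y, linear0);
       freeg_ring.
  + have E' := (YF 0 0 ltac:(lia) ltac:(lia), YF 1 0 ltac:(lia) ltac:(lia),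
      YF 2 0 ltac:(lia) ltac:(lia)).
    by rewrite !(E, E', linearB X, linearB Y, linearZ_LR X, linearZ_LR Y, linear0);
       freeg_ring.
- have E := (XT 0 0 ltac:(lia), XT 1 0 ltac:(lia), XT 1 1 ltac:(lia),
    XF 0 1 ltac:(lia), YT 1 1 ltac:(lia) ltac:(lia),
    YT 0 1 ltac:(lia) ltac:(lia), F0 0 2 ltac:(lia)).
  case: (ltnP d c) => e.
  + have E' := (YT 0 0 ltac:(lia) ltac:(lia), YT 1 0 ltac:(lia) ltac:(lia),
      YT 2 0 ltac:(lia) ltac:(lia)).
    by rewrite !(E, E', linearB X, linearB Y, linearZ_LR X, linearZ_LR Y, linear0);
       freeg_ring.
  + have E' := (YF 0 0 ltac:(lia) ltac:(lia), YF 1 0 ltac:(lia) ltac:(lia),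
      YF 2 0 ltac:(lia) ltac:(lia)).
    by rewrite !(E, E', linearB X, linearB Y, linearZ_LR X, linearZ_LR Y, linear0);
       freeg_ring.
- have E := (XT 0 0 ltac:(lia), XT 1 0 ltac:(lia), XT 1 1 ltac:(lia),
    XT 0 1 ltac:(lia), YT 1 1 ltac:(lia) ltac:(lia),
    YT 0 1 ltac:(lia) ltac:(lia)).
  case: (ltnP d c) => e.
  + have E' := (YT 0 0 ltac:(lia) ltac:(lia), YT 1 0 ltac:(lia) ltac:(lia),
      YT 2 0 ltac:(lia) ltac:(lia)).
    by rewrite !(E, E', linearB X, linearB Y, linearZ_LR X, linearZ_LR Y, linear0);
       freeg_ring.
  + have E' := (YF 0 0 ltac:(lia) ltac:(lia), YF 1 0 ltac:(lia) ltac:(lia),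
      YF 2 0 ltac:(lia) ltac:(lia)).
    by rewrite !(E, E', linearB X, linearB Y, linearZ_LR X, linearZ_LR Y, linear0);
       freeg_ring.
Qed.

Lemma upt_knuth i : knuth (upt beta i.+1) (upt beta i).
Proof.
set X : {linear V -> V} := upt beta i; set Y : {linear V -> V} := upt beta i.+1.
move=> v; apply: (@cw_linear_eq _
  (((Y \o (X \o Y)) \+ (Y \o (X \o X))) : {linear V -> V})
  (((Y \o (Y \o X)) \+ (X \o (Y \o X))) : {linear V -> V})).
move=> {v} f cf /=.
pose F p q := cw (fun k => f k + p * (k == i) + q * (k == i.+1))%N.
have b1 := cols_leq cf (leqnSn i); have b2 := cols_leq cf (leqnSn i.+1).
have F0 p q : (f i + p < f i.+1 + q)%N -> F p q = 0.
  by move=> lt; rewrite /F (@cw_eq0 _ _ i) //; lia.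
(* [F p q] also vanishes when column [i] outgrows its left neighbour, which [local_knuth] does not
   see; both sides of [XE] and [YE] are then 0. *)
have Ftop p q : (0 < i)%N -> (f i.-1 < f i + p)%N -> F p q = 0.
  by move=> i0 lt; rewrite /F (@cw_eq0 _ _ i.-1) // prednK //; lia.
have FS p q : cw (fun k => f k + p * (k == i) + q * (k == i.+1) + (k == i))%N
    = F p.+1 q by apply: eq_cw => k; lia.
have FS' p q : cw (fun k => f k + p * (k == i) + q * (k == i.+1) + (k == i.+1))%N
    = F p q.+1 by apply: eq_cw => k; lia.
have colsF p q : (f i.+1 + q <= f i + p)%N -> (0 < i -> f i + p <= f i.-1)%N ->
    cols (fun k => f k + p * (k == i) + q * (k == i.+1))%N.
  move=> le lt; apply: (@cols_sub_bounded _ _ i.+1 cf) => [k|k ik].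
    case: cf => /(_ k) fk _; case: (k =P i) lt => [->|ki]; first by lia.
    case: (k.+1 =P i) => [<-|ki'] /= lt; first by lia.
    by case: (k =P i.+1) => [->|]; lia.
  have -> : (k == i) = false by lia.
  have -> : (k == i.+1) = false by lia.
  by rewrite !muln0 !addn0.
have XE p q : (f i.+1 + q <= f i + p)%N -> X (F p q) =
    F p.+1 q - (if (f i.+1 + q < f i + p)%N then beta *: F p q else 0).
  move=> le; have [/andP[i0 lt]|] := boolP ((0 < i) && (f i.-1 < f i + p))%N.
    rewrite !Ftop // ?linear0 ?scaler0 ?if_same ?subr0 //; lia.
  rewrite negb_and -leqNgt => ok; rewrite /X /= [F p q]/F upt_cw; last first.
    by apply: colsF => // i0; lia.
  by rewrite FS [X in if X then _ else _](_ : _ = (f i.+1 + q < f i + p)%N) //; lia.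
have YE p q : (f i.+1 + q <= f i + p)%N -> Y (F p q) =
    F p q.+1 - (if (f i.+2 < f i.+1 + q)%N then beta *: F p q else 0).
  move=> le; have [/andP[i0 lt]|] := boolP ((0 < i) && (f i.-1 < f i + p))%N.
    by rewrite !Ftop // ?linear0 ?scaler0 ?if_same ?subr0.
  rewrite negb_and -leqNgt => ok; rewrite /Y /= [F p q]/F upt_cw; last first.
    by apply: colsF => // i0; lia.
  by rewrite FS' [X in if X then _ else _](_ : _ = (f i.+2 < f i.+1 + q)%N) //; lia.
have <- : F 0 0 = cw f by apply: eq_cw => k; lia.
exact: (local_knuth b1 b2 F0 XE YE).
Qed.
End UpTilde.

(** * Relations between the box-removing operators *)

Section DownTilde.
Context (R : comNzRingType) (beta : R).
Local Notation V := (RP R).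
Local Notation cw := (@cw R).
Implicit Types (f g : nat -> nat) (la mu : intpart) (i j : nat) (v w : V).

(** The length of column [i] bounds the number of steps on a basis vector, and a general vector has
    finite support. *)
Lemma locally_nilpotent i (T : {linear V -> V}) :
  (forall f, cols f -> T (cw f) = 0 \/
     exists g, [/\ cols g, T (cw f) = cw g & (g i < f i)%N]) ->
  forall v, eventually (fun n => iter n T v = 0).
Proof.
move=> HT.
have nil n f : cols f -> (f i < n)%N -> iter n T (cw f) = 0.
  elim: n f => // n IH f cf fn; rewrite iterSr.
  case: (HT f cf) => [->|[g [cg -> gf]]]; first by rewrite linear0.
  by apply: IH => //; apply: leq_trans gf _.
elim/freeg_ind_dom0 => [|a la v _ _].
  by apply: eventuallyT => n; rewrite linear0.
have : eventually (fun n => iter n T << la >> = 0).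
  by exists (collen la i).+1 => n lan; rewrite -[<< la >>]cw_collen nil //;
    exact: cols_collen.
move=> h1 h2; move: (eventually_and h1 h2); apply: eventually_imp => n [e1 e2].
by rewrite freegZU linearP /= e1 e2 scaler0 addr0.
Qed.

Lemma dn_nilpotent i v : eventually (fun n => iter n (@dn R i) v = 0).
Proof.
apply: (@locally_nilpotent i (@dn R i)) => f cf /=; rewrite dn_cw //.
case: ltnP => fi; last by left.
right; exists (fun k => f k - (k == i))%N; split => //; first exact: cols_dn.
by rewrite eqxx; lia.
Qed.

Lemma dntE i v : eventually (fun n =>
  dnt beta i v = \sum_(k < n) beta ^+ k *: iter k.+1 (@dn R i) v).
Proof.
case: (dn_nilpotent i v) => N nil; exists N => n Nn; rewrite /dnt.
rewrite (fsbigE (iota 1 n)) ?iota_uniq //=.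
- rewrite -(big_mkord xpredT (fun k => beta ^+ k *: iter k.+1 (@dn R i) v)).
  rewrite /index_iota subn0 -[1%N]addn0 iotaDl big_map.
  by apply: eq_big => [k|k _]; [exact: mem_set|].
- by move=> k /=; rewrite mem_iota => /andP[].
- move=> k /= k0; rewrite mem_iota k0 /= -leqNgt add1n => nk.
  by rewrite nil ?scaler0 //; lia.
Qed.

Lemma dnt_is_linear i : linear (dnt beta i).
Proof.
move=> a v w; apply: eventually_const.
have := eventually_and (dntE i (a *: v + w))
          (eventually_and (dntE i v) (dntE i w)).
apply: eventually_imp => n [-> [-> ->]].
rewrite scaler_sumr -big_split; apply: eq_bigr => k _ /=.
by rewrite iter_is_linear linearP scalerDr !scalerA mulrC.
Qed.

HB.instance Definition _ i :=
  GRing.isLinear.Build R V V *:%R (dnt beta i) (dnt_is_linear i).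

Lemma dnt_commute i (S : {linear V -> V}) :
  commute_op S (@dn R i) -> commute_op S (dnt beta i).
Proof.
move=> Sd v; rewrite /=; apply: eventually_const.
have := eventually_and (dntE i v) (dntE i (S v)).
apply: eventually_imp => n [-> ->]; rewrite linear_sum.
apply: eq_bigr => k _; rewrite linearZ_LR; congr (_ *: _).
by elim: k.+1 => //= m <-; rewrite Sd.
Qed.

(** This and [dn_dnt] unfold $\widetilde d = d (1 - \beta d)^{-1}$ once, with $d$ to the right and
    to the left of $\widetilde d$. *)
Lemma dnt_dn i v : dnt beta i v = dn i v + beta *: dnt beta i (dn i v).
Proof.
apply: eventually_const.
have [N hN] := eventually_and (dntE i v) (dntE i (dn i v)).
exists N => n Nn; have [_ ->] := hN _ Nn; have [-> _] := hN _ (leqW Nn).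
rewrite big_ord_recl expr0 scale1r scaler_sumr; congr (_ + _).
by apply: eq_bigr => k _; rewrite lift0 exprS scalerA -iterSr.
Qed.

Lemma dn_dnt i v : dnt beta i v = dn i (v + beta *: dnt beta i v).
Proof.
have c : commute_op (@dn R i) (dnt beta i) by apply: dnt_commute.
by rewrite linearD linearZ_LR /= (c v : dn i (dnt beta i v) = _) -dnt_dn.
Qed.

Lemma dnt_far i j : (i.+1 < j)%N -> commute_op (dnt beta i) (dnt beta j).
Proof.
move=> ij; apply: dnt_commute => v; apply/esym; move: v.
by apply: dnt_commute => v; rewrite [RHS](dndnC ij v).
Qed.

Lemma dnt_finite v : exists m, forall i, (m < i)%N -> dnt beta i v = 0.
Proof.
elim/freeg_ind_dom0: v => [|a la v _ _ [m mv]].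
  by exists 0%N => i _; rewrite linear0.
exists (maxn m (row la 0)) => i; rewrite gtn_max => /andP[mi lai].
rewrite freegZU linearP /= mv // addr0 dnt_dn.
suff -> : dn i << la >> = 0 :> V by rewrite linear0 scaler0 addr0 scaler0.
rewrite -[<< la >>]cw_collen dn_cw; last exact: cols_collen.
suff -> : collen la i = 0%N by [].
by apply/eqP; rewrite -leqn0 leqNgt ltn_collen -leqNgt ltnW.
Qed.

(** Removing a box from column [i.+1] makes one removable in column [i], so [dn i \o dn i.+1] is
    nonzero on a partition exactly when column [i.+1] is longer than the next. Comparing conditions
    gives the local plactic relations, by which this composite commutes with both factors. *)
Lemma dnn_commute i (v : V) :
  dn i (dn i (dn i.+1 v)) = dn i (dn i.+1 (dn i v)) /\
  dn i.+1 (dn i (dn i.+1 v)) = dn i (dn i.+1 (dn i.+1 v)).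
Proof.
pose d := fun i => (@dn R i : {linear V -> V}).
split.
  apply: (@cw_linear_eq _ (d i \o (d i \o d i.+1)) (d i \o (d i.+1 \o d i))).
  move=> f cf; rewrite /d /=.
  have m1 := cols_leq cf (leqnSn i).
  have m2 := cols_leq cf (leqnSn i.+1).
  rewrite !(dn_cw _ _ cf).
  case: (ltnP (f i.+2) (f i.+1)) => f2; last first.
    rewrite !linear0; case: ltnP => f1; last by rewrite !linear0.
    rewrite (dn_cw _ _ (cols_dn cf f1)) ifF ?linear0 //; lia.
  have c2 := cols_dn cf f2; rewrite (dn_cw _ _ c2) ifT; last by lia.
  have c12 : cols (fun k => f k - (k == i.+1) - (k == i))%N.
    by apply: cols_dn => //; lia.
  rewrite (dn_cw _ _ c12); case: (ltnP (f i.+1) (f i)) => f1; last first.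
    by rewrite !linear0 ifF //; lia.
  have c1 := cols_dn cf f1; rewrite (dn_cw _ _ c1) !ifT; try by lia.
  have c21 : cols (fun k => f k - (k == i) - (k == i.+1))%N.
    by apply: cols_dn => //; lia.
  rewrite (dn_cw _ _ c21) ifT; last by lia.
  by apply: eq_cw => k; lia.
apply: (@cw_linear_eq _ (d i.+1 \o (d i \o d i.+1)) (d i \o (d i.+1 \o d i.+1))).
move=> f cf; rewrite /d /=.
have m1 := cols_leq cf (leqnSn i).
have m2 := cols_leq cf (leqnSn i.+1).
rewrite !(dn_cw _ _ cf).
case: (ltnP (f i.+2) (f i.+1)) => f2; last by rewrite !linear0.
have c2 := cols_dn cf f2; rewrite !(dn_cw _ _ c2) ifT; last by lia.
have c12 : cols (fun k => f k - (k == i.+1) - (k == i))%N.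
  by apply: cols_dn => //; lia.
rewrite (dn_cw _ _ c12); case: (ltnP (f i.+2) (f i.+1 - 1)) => f2'; last first.
  by rewrite !ifF ?linear0 //; lia.
rewrite !ifT; try by lia.
have c22 : cols (fun k => f k - (k == i.+1) - (k == i.+1))%N.
  by apply: cols_dn => //; lia.
rewrite (dn_cw _ _ c22) ifT; last by lia.
by apply: eq_cw => k; lia.
Qed.

Lemma dnn_nilpotent i v :
  eventually (fun n => iter n (@dn R i \o @dn R i.+1) v = 0).
Proof.
apply: (@locally_nilpotent i (@dn R i \o @dn R i.+1 : {linear V -> V})).
move=> f cf /=; rewrite dn_cw //; have m1 := cols_leq cf (leqnSn i).
case: ltnP => f2; last by left; rewrite linear0.
right; have c2 := cols_dn cf f2; rewrite (dn_cw _ _ c2) ifT; last by lia.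
exists (fun k => f k - (k == i.+1) - (k == i))%N; split => //; last by lia.
by apply: cols_dn => //; lia.
Qed.

(* Put [s = D1 + D2]. Since [D1 D2 = p (1 + beta s + beta^2 D1 D2)], the operator
   [beta^2 p] fixes all values of the commutator of [D1 D2] and [s], which must
   vanish as [p] is locally nilpotent. *)
Lemma knuth_nilpotent (D1 D2 p : {linear V -> V}) :
  commute_op p D1 -> commute_op p D2 ->
  (forall v, D1 (D2 v) =
    p (v + beta *: D1 v + beta *: D2 v + (beta * beta) *: D1 (D2 v))) ->
  (forall v, eventually (fun n => iter n p v = 0)) -> knuth D1 D2.
Proof.
move=> pD1 pD2 DD nilp.
pose r v : V := D1 (D2 (D1 v)) + D1 (D2 (D2 v)) - (D1 (D1 (D2 v)) + D2 (D1 (D2 v))).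
have fix_r v : r v = (beta * beta) *: p (r v).
  rewrite {1}/r (DD v) (DD (D1 v)) (DD (D2 v)) -pD1 -pD2.
  rewrite -!(linearD p) -(linearB p) -(linearZ_LR p); congr (p _).
  by rewrite /r !(linearD D1, linearD D2, linearZ_LR D1, linearZ_LR D2); freeg_ring.
move=> v; apply/eqP; rewrite -subr_eq0; apply/eqP; rewrite -/(r v).
apply: eventually_const; move: (nilp (r v)); apply: eventually_imp => n nil.
have -> : r v = (beta * beta) ^+ n *: iter n p (r v).
  elim: n {nil} => [|n IH]; first by rewrite expr0 scale1r.
  by rewrite {1}IH {1}fix_r linearZ_LR /= exprSr scalerA -iterS iterSr.
by rewrite nil scaler0.
Qed.

Lemma dnt_knuth i : knuth (dnt beta i) (dnt beta i.+1).
Proof.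
pose D1 : {linear V -> V} := dnt beta i; pose D2 : {linear V -> V} := dnt beta i.+1.
pose p : {linear V -> V} := @dn R i \o @dn R i.+1.
have pD1 : commute_op p D1.
  by apply: dnt_commute => v; rewrite /p /=; case: (dnn_commute i v) => ->.
have pD2 : commute_op p D2.
  by apply: dnt_commute => v; rewrite /p /=; case: (dnn_commute i v) => _ ->.
apply: (knuth_nilpotent pD1 pD2) => v; last exact: dnn_nilpotent.
(* [zE] computes $(1 + \beta D_1)(1 + \beta D_2) v$. As $D_2 v = d_{i+1} z$, unfolding $D_1$ on the
   right produces [p], which commutes with $D_1$ and can be moved to the front. *)
pose z := v + beta *: D2 v.
have zE : z + beta *: D1 z =
    v + beta *: D1 v + beta *: D2 v + (beta * beta) *: D1 (D2 v).
  by rewrite /z (linearD D1) (linearZ_LR D1); freeg_ring.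
rewrite -zE (linearD p) (linearZ_LR p) pD1.
by rewrite (dn_dnt i.+1 v : D2 v = dn i.+1 z) (dnt_dn i _ : D1 _ = _).
Qed.

End DownTilde.

Section OperatorPairs.
Context (R : comNzRingType) (beta : R).

Lemma upt_column_ops : column_ops (fun i => upt beta i : {linear RP R -> RP R}).
Proof. by split; [exact: upt_far|exact: upt_finite]. Qed.

Lemma dnt_column_ops : column_ops (fun i => dnt beta i : {linear RP R -> RP R}).
Proof. by split; [exact: dnt_far|exact: dnt_finite]. Qed.

Lemma opA_eh_pair : eh_pair (opA beta) (opAbar beta).
Proof. exact: (oprodl_eh_pair upt_column_ops (upt_knuth beta)). Qed.

Lemma opB_eh_pair : eh_pair (opB beta) (opBbar beta).
Proof. exact: (oprodr_eh_pair dnt_column_ops (dnt_knuth beta)). Qed.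

End OperatorPairs.

(** * Horizontal strips *)

Section Sizes.
Implicit Types (la mu nu : intpart).

Definition psize la := sumn (val la).

Lemma sumn_count_ltn (s : seq nat) M : all (geq M) s ->
  sumn s = (\sum_(j < M) count (ltn j) s)%N.
Proof.
elim: s => [|x s IH] /=; first by rewrite big1.
move=> /andP[xM /IH->]; rewrite big_split; congr (_ + _)%N.
rewrite -[LHS](minn_idPl xM) {xM IH}; elim: M => [|M IH].
  by rewrite big_ord0 minn0.
by rewrite big_ord_recr -IH /=; lia.
Qed.

Lemma psize_collen la M : (row la 0 <= M)%N ->
  psize la = (\sum_(j < M) collen la j)%N.
Proof.
move=> leM; apply: sumn_count_ltn; apply/(all_nthP 0%N) => r _ /=.
apply: leq_trans leM; rewrite leqNgt -ltn_collen -leqNgt.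
by rewrite leqNgt ltn_collen -leqNgt /=; elim: r => // r; apply: leq_trans; exact: row_nonincr.
Qed.

Lemma psize_conj la : psize (conj_part la) = psize la.
Proof.
rewrite (@psize_collen la (row la 0)) // /psize /= /conj_seq sumnE big_map.
by rewrite -(big_mkord xpredT (collen la)) /index_iota subn0 /row nth0.
Qed.

Lemma psize_row la M : (size (val la) <= M)%N ->
  psize la = (\sum_(r < M) row la r)%N.
Proof.
move=> leM; rewrite -psize_conj (@psize_collen _ M).
  by apply: eq_bigr => r _; rewrite collen_conj.
rewrite row_conj; have := row_eq0 la M; rewrite leM => /eqP z.
by rewrite leqNgt ltn_collen z.
Qed.

Lemma row_leq_eq mu nu : (forall r, row mu r <= row nu r)%N ->
  psize nu = psize mu -> mu = nu.
Proof.
move=> le; pose M := maxn (size (val mu)) (size (val nu)).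
rewrite (@psize_row nu M) ?leq_maxr // (@psize_row mu M) ?leq_maxl // => e.
apply: row_inj => r; have [rM|Mr] := ltnP r M; last first.
  have z la : (size (val la) <= M)%N -> row la r = 0%N.
    by move=> leM; apply/eqP; rewrite row_eq0 (leq_trans leM).
  by rewrite !z ?leq_maxl ?leq_maxr.
have /leqif_sum[_] : forall s : 'I_M, xpredT s ->
    (row mu s <= row nu s ?= iff (row mu s == row nu s))%N by move=> s _; split.
by rewrite e eqxx => /esym/forallP/(_ (Ordinal rM))/eqP.
Qed.

Lemma collen_leq_row mu nu :
  (forall j, collen mu j <= collen nu j)%N <-> (forall r, row mu r <= row nu r)%N.
Proof.
split=> le r; rewrite leqNgt; apply/negP.
  by rewrite -ltn_collen => /leq_trans/(_ (le _)); rewrite ltn_collen ltnn.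
by rewrite ltn_collen => /leq_trans/(_ (le _)); rewrite -ltn_collen ltnn.
Qed.

Lemma collen_leq_eq mu nu : (forall j, collen mu j <= collen nu j)%N ->
  psize nu = psize mu -> mu = nu.
Proof. by move=> /collen_leq_row; exact: row_leq_eq. Qed.

Lemma psize_adds_box i la mu : adds_box i la mu -> psize mu = (psize la).+1.
Proof.
move=> ab; pose M := maxn i.+1 (maxn (row la 0) (row mu 0)).
have [iM [laM muM]] : (i < M /\ row la 0 <= M /\ row mu 0 <= M)%N.
  by rewrite /M !leq_max !leqnn !orbT.
rewrite (psize_collen laM) (psize_collen muM).
under eq_bigr => j _ do rewrite ab.
rewrite big_split /= -[RHS]addn1; congr (_ + _)%N.
rewrite (bigD1 (Ordinal iM)) //= eqxx big1 // => j.
by rewrite -val_eqE /= => /negbTE->.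
Qed.

Definition hstrip mu nu k := [/\ forall r, (row nu r.+1 <= row mu r)%N,
  forall r, (row mu r <= row nu r)%N & psize nu = (psize mu + k)%N].

(** Interlacing rows amount to at most one new box per column. The column form is what the operators
    produce, the row form what tableaux use. *)
Lemma hstrip_collen mu nu k : hstrip mu nu k <->
  (forall j, collen mu j <= collen nu j <= (collen mu j).+1)%N /\
  psize nu = (psize mu + k)%N.
Proof.
split=> [[il /collen_leq_row le e]|[H e]]; split => //.
- move=> j; rewrite le /= leqNgt; apply/negP; rewrite ltn_collen => lt.
  by have := leq_trans lt (il _); rewrite -ltn_collen ltnn.
- move=> r; rewrite leqNgt -ltn_collen; apply/negP => lt.
  have /andP[_ le] := H (row mu r); move: (leq_trans lt le).
  by rewrite ltnS ltn_collen ltnn.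
- by apply/collen_leq_row => j; case/andP: (H j).
Qed.

End Sizes.

(** * The action at [beta = 0]: horizontal and vertical strips *)

Section Strips.
Context (R : comNzRingType).
Local Notation V := (RP R).
Local Notation cw := (@cw R).
Local Notation U := (opA (0 : R)).
Local Notation W := (opAbar (0 : R)).
Local Notation u := (fun i => upt (0 : R) i : {linear V -> V}).
Implicit Types (la mu nu : intpart) (v w : V).

Lemma coeff_linear (T : V -> V) nu v : linear T ->
  coeff nu (T v) = \sum_(mu <- dom v) coeff mu v * coeff nu (T << mu >>).
Proof.
move=> linT; pose h := GRing.isLinear.Build R V V *:%R T linT.
pose T' : {linear V -> V} := HB.pack T h.
rewrite -{1}[v]freeg_sumE -[T]/(T' : V -> V) linear_sum raddf_sum.
by apply: eq_bigr => mu _; rewrite freegZU linearZ_LR /= coeffZ.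
Qed.

Lemma coeff_cw nu f : coeff nu (cw f) = `[< collen nu =1 f >]%:R.
Proof.
case: asboolP => [e|ne].
  by rewrite -(eq_cw _ e) cw_collen coeffU eqxx mulr1.
have [[la [laf ->]]|no] := pselect (exists la, collen la =1 f /\ cw f = << la >>).
  by rewrite coeffU; case: eqP => [e|]; rewrite ?mulr0 //; case: ne; rewrite -e.
rewrite [cw f](_ : _ = 0) ?coeff0 //.
rewrite /cw [X in finite_support _ X _](_ : _ = set0) ?fsbig_set0 //.
apply/seteqP; split => la //= laf; case: no; exists la; split=> //.
by rewrite -[<< la >>]cw_collen; apply: eq_cw => k; rewrite laf.
Qed.

Lemma upt0 i v : upt 0 i v = up i v.
Proof. by rewrite /upt scale0r subr0. Qed.

Lemma up_part i la : up i << la >> = cw (fun k => collen la k + (k == i))%N.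
Proof. by rewrite -[<< la >>]cw_collen up_cw //; exact: cols_collen. Qed.

Lemma coeff_up_adds_box i nu nu' v : adds_box i nu' nu ->
  coeff nu (upt 0 i v) = coeff nu' v.
Proof.
move=> ab; rewrite upt0 (@coeff_linear (@up R i)); last exact: up_is_linear.
rewrite -[v in RHS]freeg_sumE raddf_sum; apply: eq_bigr => mu _ /=.
rewrite coeffU up_part coeff_cw; congr (_ * (nat_of_bool _)%:R).
apply: (asbool_equiv_eqP eqP); split=> [e|->].
  by apply: collen_inj => k; have := e k; rewrite ab; lia.
by move=> k; rewrite ab.
Qed.

Lemma coeff_up_eq0 i nu v : (forall nu', ~ adds_box i nu' nu) ->
  coeff nu (upt 0 i v) = 0.
Proof.
move=> no; rewrite upt0 (@coeff_linear (@up R i)); last exact: up_is_linear.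
apply: big1 => mu _; rewrite up_part coeff_cw asboolF ?mulr0 // => e.
exact: (no mu).
Qed.

Lemma coeff_part mu nu (P : Prop) : (P <-> mu = nu) ->
  coeff nu << mu >> = `[< P >]%:R :> R.
Proof.
move=> Pe; rewrite coeffU mul1r; congr (nat_of_bool _)%:R.
exact/esym/(asbool_equiv_eqP eqP).
Qed.

(** The columns receive boxes from left to right, at most one each. The induction inspects the last
    column: it is unchanged, or its new box is taken off [nu]; accordingly only one of the two terms
    of [elsS] can survive. *)
Lemma coeff_els_up n k mu nu : coeff nu (els (rev (mkseq u n)) k << mu >>) =
  `[< [/\ forall j, (collen mu j <= collen nu j <= (collen mu j).+1)%N,
        forall j, (n <= j)%N -> collen nu j = collen mu j
      & psize nu = (psize mu + k)%N] >]%:R.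
Proof.
elim: n k nu => [|n IH] [|k] nu.
- apply: coeff_part; split=> [[H _]|->]; last first.
    by split=> // => [j|]; rewrite ?leqnn ?leqnSn ?addn0.
  by rewrite addn0; apply: collen_leq_eq => j; case/andP: (H j).
- rewrite /= coeff0 asboolF // => -[_ H].
  by rewrite (_ : nu = mu); [lia|apply: collen_inj => j; exact: H].
- rewrite els0; apply: coeff_part; split=> [[H _]|->]; last first.
    by split=> // => [j|]; rewrite ?leqnn ?leqnSn ?addn0.
  by rewrite addn0; apply: collen_leq_eq => j; case/andP: (H j).
rewrite mkseqS rev_rcons elsS coeffD IH.
have [en|nen] := eqVneq (collen nu n) (collen mu n).
  rewrite [X in _ + X](_ : _ = 0) ?addr0.
    congr (nat_of_bool _)%:R; apply: asbool_equiv_eq; split=> -[H1 H2 H3]; split=> // j nj;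
      first exact/H2/ltnW.
    by move: nj; rewrite leq_eqVlt => /orP[/eqP<-//|/H2].
  have [[nu' ab]|no] := pselect (exists nu', adds_box n nu' nu); last first.
    by rewrite coeff_up_eq0 // => nu' ab; apply: no; exists nu'.
  rewrite (coeff_up_adds_box _ ab) IH asboolF // => -[H _ _].
  by have := H n; have := ab n; rewrite eqxx en; lia.
rewrite asboolF ?add0r; last by move=> [_ H _]; rewrite H ?eqxx in nen.
have [[nu' ab]|no] := pselect (exists nu', adds_box n nu' nu).
  rewrite (coeff_up_adds_box _ ab) IH; congr (nat_of_bool _)%:R; apply: asbool_equiv_eq.
  have abn := ab n; rewrite eqxx in abn.
  have sz := psize_adds_box ab.
  split=> -[H1 H2 H3]; split.
  - move=> j; rewrite ab; have := H1 j; case: (j =P n) => [->|_]; last by lia.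
    by rewrite H2 //; lia.
  - by move=> j nj; rewrite ab H2 ?(ltnW nj) // (_ : (j == n) = false) ?addn0 //; lia.
  - by lia.
  - move=> j; have := H1 j; rewrite ab; case: (j =P n) => [->|_]; last by lia.
    by move: nen; have := H1 n; rewrite abn; lia.
  - move=> j; rewrite leq_eqVlt => /orP[/eqP<-|nj].
      by move: nen; have := H1 n; rewrite abn; lia.
    by rewrite -(H2 j nj) ab (_ : (j == n) = false) ?addn0 //; lia.
  - by lia.
rewrite coeff_up_eq0; last by move=> nu' ab; apply: no; exists nu'.
rewrite asboolF // => -[H1 H2 H3]; apply: no.
have cn : (collen nu n.+1 < collen nu n)%N.
  have := H1 n; rewrite (H2 n.+1) //; have := collen_nonincr mu n.
  by move: nen; lia.
have [nu' e] := cols_part (cols_dn (cols_collen nu) cn); exists nu' => j.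
by rewrite e; case: (j =P n) => [->|]; lia.
Qed.

(** The columns are filled from right to left with any number of boxes, which gives vertical strips.
    As the head of the list acts first, a box of the last column is added to [mu] instead of being
    taken off [nu], whence the inner induction on [k] for all [mu]. *)
Lemma coeff_hls_up n k mu nu : coeff nu (hls (rev (mkseq u n)) k << mu >>) =
  `[< [/\ forall j, (collen nu j.+1 <= collen mu j <= collen nu j)%N,
        forall j, (n <= j)%N -> collen nu j = collen mu j
      & psize nu = (psize mu + k)%N] >]%:R.
Proof.
have base n' mu' : coeff nu (hls (rev (mkseq u n')) 0 << mu' >>) =
  `[< [/\ forall j, (collen nu j.+1 <= collen mu' j <= collen nu j)%N,
        forall j, (n' <= j)%N -> collen nu j = collen mu' j
      & psize nu = (psize mu' + 0)%N] >]%:R.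
  rewrite hls0; apply: coeff_part; split=> [[H _]|->].
    by rewrite addn0; apply: collen_leq_eq => j; case/andP: (H j).
  by split=> // => [j|]; rewrite ?addn0 ?collen_nonincr ?leqnn.
elim: n k mu => [|n IHn] k mu.
  case: k => // k; rewrite /= coeff0 asboolF // => -[_ H].
  by rewrite (_ : nu = mu); [lia|apply: collen_inj => j; exact: H].
elim: k mu => // k IHk mu.
rewrite mkseqS rev_rcons hlsS -rev_rcons -mkseqS coeffD IHn [X in hls _ k X]upt0.
rewrite up_part.
have [en|nen] := eqVneq (collen nu n) (collen mu n).
  rewrite [X in _ + X](_ : _ = 0) ?addr0.
    congr (nat_of_bool _)%:R; apply: asbool_equiv_eq; split=> -[H1 H2 H3]; split=> // j nj;
      first exact/H2/ltnW.
    by move: nj; rewrite leq_eqVlt => /orP[/eqP<-//|/H2].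
  have [[mu' ab]|no] := pselect (exists mu', adds_box n mu mu'); last first.
    rewrite (_ : cw _ = 0) ?linear0 ?coeff0 //; apply/eqP/freeg_eqP => x.
    by rewrite coeff_cw coeff0 asboolF // => e; apply: no; exists x.
  rewrite -(eq_cw _ ab) cw_collen IHk asboolF // => -[H _ _].
  by have := H n; have := ab n; rewrite eqxx en; lia.
rewrite asboolF ?add0r; last by move=> [_ H _]; rewrite H ?eqxx in nen.
have [[mu' ab]|no] := pselect (exists mu', adds_box n mu mu').
  rewrite -(eq_cw _ ab) cw_collen IHk; congr (nat_of_bool _)%:R; apply: asbool_equiv_eq.
  have abn := ab n; rewrite eqxx in abn.
  have sz := psize_adds_box ab.
  split=> -[H1 H2 H3]; split.
  - move=> j; have := H1 j; rewrite ab; case: (j =P n) => [->|_]; last by lia.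
    by have := collen_nonincr mu n; have := H2 n.+1 (leqnn _); have := ab n.+1; lia.
  - by move=> j nj; rewrite H2 // ab (_ : (j == n) = false) ?addn0 //; lia.
  - by lia.
  - move=> j; have := H1 j; rewrite ab; case: (j =P n) => [->|_]; last by lia.
    by move: nen; have := H1 n; lia.
  - by move=> j nj; rewrite ab H2 // (_ : (j == n) = false) ?addn0 //; lia.
  - by lia.
rewrite (_ : cw _ = 0) ?linear0 ?coeff0; last first.
  apply/eqP/freeg_eqP => x.
  by rewrite coeff_cw coeff0 asboolF // => e; apply: no; exists x.
rewrite asboolF // => -[H1 H2 H3]; apply: no.
have cn : (0 < n)%N -> (collen mu n < collen mu n.-1)%N.
  by case: n nen {IHn IHk H2} => // n nen _ /=; have := H1 n.+1; have := H1 n; lia.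
by have [mu' e] := cols_part (cols_up (cols_collen mu) cn); exists mu' => j.
Qed.

Lemma coeff_U nu k mu : coeff nu (U k << mu >>) = `[< hstrip mu nu k >]%:R.
Proof.
have [N hN] := oprodlD1_converges (upt_column_ops (0 : R)) k << mu >>.
(* From [M] on the columns of both partitions are empty, so the condition on these columns holds
   automatically. *)
pose M := maxn N (maxn (row mu 0) (row nu 0)).
have -> : U k << mu >> = els (rev (mkseq u M)) k << mu >>.
  exact/esym/hN/leq_maxl.
rewrite coeff_els_up; congr (nat_of_bool _)%:R.
apply: asbool_equiv_eq; split=> [[H1 _ H3]|/hstrip_collen[H1 H3]].
  by apply/hstrip_collen.
split=> // j Mj.
have z la : (row la 0 <= M)%N -> collen la j = 0%N.
  by move=> le; apply/eqP; rewrite -leqn0 leqNgt ltn_collen -leqNgt (leq_trans le).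
by rewrite !z // /M !leq_max leqnn ?orbT.
Qed.

Lemma coeff_W nu k mu :
  coeff nu (W k << mu >>) = `[< hstrip (conj_part mu) (conj_part nu) k >]%:R.
Proof.
have [N hN] := oprodr_geom_converges (upt_column_ops (0 : R)) k << mu >>.
pose M := maxn N (maxn (row mu 0) (row nu 0)).
have -> : W k << mu >> = hls (rev (mkseq u M)) k << mu >>.
  exact/esym/hN/leq_maxl.
rewrite coeff_hls_up; congr (nat_of_bool _)%:R.
apply: asbool_equiv_eq; split=> [[H1 _ H3]|[H1 H2 H3]].
  by split=> [r|r|]; rewrite ?row_conj ?psize_conj //; case/andP: (H1 r).
split=> [j|j Mj|]; last by rewrite !psize_conj in H3.
  by have := H1 j; have := H2 j; rewrite !row_conj => -> ->.
have z la : (row la 0 <= M)%N -> collen la j = 0%N.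
  by move=> le; apply/eqP; rewrite -leqn0 leqNgt ltn_collen -leqNgt (leq_trans le).
by rewrite !z // /M !leq_max leqnn ?orbT.
Qed.

End Strips.

(** * Unitriangularity of the Kostka numbers *)

Definition part0 : intpart := exist (fun s => is_part s) [::] isT.

Lemma row_part0 r : row part0 r = 0%N.
Proof. by rewrite /row /= nth_nil. Qed.

Lemma opcoef_rcons (R : comNzRingType) (T : opser R) v a k :
  opcoef T v (rcons a k) = T k (opcoef T v a).
Proof. by rewrite /opcoef foldl_rcons. Qed.

Section Triangularity.
Context (R : comNzRingType).
Local Notation U := (opA (0 : R)).
Local Notation Ucoef := (opcoef U << part0 >>).
Implicit Types (la mu nu : intpart) (a : seq nat).

(** The statistic $n(\lambda)$, the sum of the row indices of all boxes. It takes the place of the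
    dominance order and allows recursion on a natural number. *)
Definition rank la := (\sum_(r < size (val la)) r * row la r)%N.

Definition seq_rank a := (\sum_(r < size a) r * nth 0 a r)%N.

Lemma rankE la M : (size (val la) <= M)%N ->
  rank la = (\sum_(r < M) r * row la r)%N.
Proof.
move=> leM; rewrite /rank (big_ord_widen _ (fun r => r * row la r)%N leM).
rewrite big_mkcond; apply: eq_bigr => r _; case: ltnP => // ge.
by move: ge; rewrite -row_eq0 => /eqP->; rewrite muln0.
Qed.

Lemma coeff_U_sum nu k v : coeff nu (U k v) =
  \sum_(mu <- dom v) coeff mu v * `[< hstrip mu nu k >]%:R.
Proof.
rewrite coeff_linear; last exact: eh_linE (opA_eh_pair 0) k.
by apply: eq_bigr => mu _; rewrite coeff_U.
Qed.

Lemma coeff_U_neq0 nu k v : coeff nu (U k v) != 0 ->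
  exists2 mu, coeff mu v != 0 & hstrip mu nu k.
Proof.
rewrite coeff_U_sum => nz.
have [[mu nzmu st]|no] := pselect (exists2 mu, coeff mu v != 0 & hstrip mu nu k).
  by exists mu.
case/negP: nz; apply/eqP; rewrite big_seq big1 // => mu.
rewrite mem_dom => nzmu; rewrite asboolF ?mulr0 // => st.
by apply: no; exists mu.
Qed.

(* A box added at step [m] (counted from 0) lies in one of the rows [0 .. m]. *)
Lemma hstrip_rank mu nu k m : hstrip mu nu k -> (size (val mu) <= m)%N ->
  [/\ (size (val nu) <= m.+1)%N, (rank nu <= rank mu + m * k)%N &
    rank nu = (rank mu + m * k)%N ->
      row nu m = k /\ forall r, (r < m)%N -> row nu r = row mu r].
Proof.
move=> [il le sz] mum.
have num : (size (val nu) <= m.+1)%N.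
  rewrite -row_eq0 -leqn0; apply: leq_trans (il m) _.
  by rewrite leqn0 row_eq0.
(* Each box added in row [r] lowers the rank by $m - r$ from its maximum, reached when all boxes go
   to row [m]. *)
have key : (rank nu + \sum_(r < m) (m - r) * (row nu r - row mu r) = rank mu + m * k)%N.
  have ksz : (\sum_(r < m) (row nu r - row mu r) + row nu m = k)%N.
    move: sz; rewrite (psize_row mum) (psize_row num) big_ord_recr /=.
    have -> : (\sum_(r < m) row nu r =
        \sum_(r < m) row mu r + \sum_(r < m) (row nu r - row mu r))%N.
      by rewrite -big_split; apply: eq_bigr => r _ /=; rewrite subnKC.
    by rewrite -addnA => /addnI.
  rewrite -ksz (rankE num) (rankE mum) big_ord_recr /= mulnDr addnAC addnA.
  congr (_ + _)%N; rewrite big_distrr -!big_split; apply: eq_bigr => r _ /=.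
  have := le r; have := ltn_ord r; set x := row nu r; set y := row mu r => rm yx.
  by rewrite -[X in (r * X)%N](subnKC yx) mulnDr -addnA -mulnDl subnKC // ltnW.
split=> //; first by rewrite -key leq_addr.
move=> e; have /eqP : (\sum_(r < m) (m - r) * (row nu r - row mu r) = 0)%N by lia.
rewrite sum_nat_eq0 => /forallP z.
have rows r : (r < m)%N -> row nu r = row mu r.
  move=> rm; have := z (Ordinal rm); rewrite /= muln_eq0 !subn_eq0 leqNgt rm /=.
  by move=> ge; apply/eqP; rewrite eqn_leq ge le.
split=> //; move: sz; rewrite (psize_row mum) (psize_row num) big_ord_recr /=.
rewrite (eq_bigr (fun r : 'I_m => row mu r)); last by move=> r _; exact: rows.
by move/addnI.
Qed.

Lemma seq_rank_rcons a k : seq_rank (rcons a k) = (seq_rank a + size a * k)%N.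
Proof.
rewrite /seq_rank size_rcons big_ord_recr /= nth_rcons ltnn eqxx.
by congr (_ + _)%N; apply: eq_bigr => r _; rewrite nth_rcons ltn_ord.
Qed.

(** In a tableau of shape [nu] and content [a] the row index of a box is at most its entry. Summing
    over the boxes compares the ranks; equality forces each entry to be its row index. *)
Lemma Ucoef_rank nu a : coeff nu (Ucoef a) != 0 ->
  [/\ (size (val nu) <= size a)%N, (rank nu <= seq_rank a)%N &
    rank nu = seq_rank a -> row nu =1 nth 0%N a].
Proof.
elim/last_ind: a nu => [|a k IH] nu.
  rewrite /= coeffU mul1r; case: (part0 =P nu) => [<- _|_]; last by rewrite eqxx.
  by split; rewrite ?/rank ?big_ord0.
rewrite opcoef_rcons => /coeff_U_neq0[mu /IH[szmu rkmu eqmu] st].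
have [sz rk eqr] := hstrip_rank st szmu.
rewrite size_rcons seq_rank_rcons; split=> //; first by lia.
move=> e; have [|em er] := eqr; first by lia.
move=> r; rewrite nth_rcons; case: ltnP => ra.
  by rewrite er // eqmu //; lia.
case: eqP => [->//|nra]; apply/eqP; rewrite row_eq0.
by apply: leq_trans sz _; rewrite ltn_neqAle ra andbT eq_sym; apply/eqP.
Qed.

(** Only [mu0] contributes at the last step: a contributing [mu] lies in [nu] and has at most
    [size a] rows, hence lies in [mu0], and it has the same size. *)
Lemma Ucoef_diag nu a : row nu =1 nth 0%N a -> coeff nu (Ucoef a) = 1.
Proof.
elim/last_ind: a nu => [|a k IH] nu rows.
  rewrite /= coeffU mul1r (_ : part0 = nu) ?eqxx //.
  by apply: row_inj => r; rewrite rows row_part0 nth_nil.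
have [mu0 rows0] : exists mu0, row mu0 =1 nth 0%N a.
  apply: cols_rows; split=> [r|]; last by exists (size a); rewrite nth_default.
  have [lt|ge] := ltnP r.+1 (size a); last by rewrite nth_default.
  by have := row_nonincr nu r; rewrite !rows !nth_rcons lt (ltnW lt).
have sz0 : (size (val mu0) <= size a)%N by rewrite -row_eq0 rows0 nth_default.
have szn : (size (val nu) <= (size a).+1)%N.
  by rewrite -row_eq0 rows nth_default // size_rcons.
have psz : psize nu = (psize mu0 + k)%N.
  rewrite (psize_row szn) (psize_row sz0) big_ord_recr /= rows nth_rcons ltnn eqxx.
  by congr (_ + _)%N; apply: eq_bigr => r _; rewrite rows rows0 nth_rcons ltn_ord.
have le0 r : (row mu0 r <= row nu r)%N.
  rewrite rows rows0 nth_rcons; case: ltnP => // ge.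
  by rewrite (nth_default _ ge).
have il0 r : (row nu r.+1 <= row mu0 r)%N.
  rewrite rows0; have [lt|ge] := ltnP r (size a).
    by have := row_nonincr nu r; rewrite !rows [X in (_ <= X)%N]nth_rcons lt.
  by rewrite rows nth_default // size_rcons.
have c0 := IH _ rows0.
rewrite opcoef_rcons coeff_U_sum (bigD1_seq mu0) ?uniq_dom ?mem_dom ?c0 ?oner_eq0 //=.
rewrite asboolT ?mulr1; last by split.
rewrite big_seq_cond big1 ?addr0 // => mu /andP[]; rewrite mem_dom => nz /eqP ne.
rewrite asboolF ?mulr0 // => -[_ le sz]; apply: ne; apply: row_leq_eq => [r|]; last by lia.
have [szmu _ _] := Ucoef_rank nz; rewrite rows0; have := le r.
rewrite rows nth_rcons; case: ltnP => // ge _.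
by have := row_eq0 mu r; rewrite (leq_trans szmu ge) => /eqP->.
Qed.

(** [D la] is a finite combination of partitions of smaller rank, so the triangular system is solved
    by recursion on the rank. The argument [m] of [c] is fuel: by [stab], the value at [la] is the
    same for all [m] above its rank. *)
Lemma Ucoef_solve (f : seq nat -> R) :
  exists c : intpart -> R^o, forall la, fglift c (Ucoef (val la)) = f (val la).
Proof.
pose D la := Ucoef (val la) - << la >>.
pose fix c (m : nat) (la : intpart) {struct m} : R^o :=
  if m is m'.+1 then f (val la) - fglift (c m') (D la) else 0.
have domD la x : x \in dom (D la) -> (rank x < rank la)%N.
  rewrite mem_dom coeffB coeffU mul1r; have [->|ne] := eqVneq la x.
    by rewrite Ucoef_diag // subrr eqxx.
  rewrite subr0 => /Ucoef_rank[_ le eqx]; rewrite ltn_neqAle le andbT.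
  by apply/eqP => /eqx rows; case/eqP: ne; apply/esym/row_inj.
have stab m m' la : (rank la < m)%N -> (rank la < m')%N -> c m la = c m' la.
  elim: m m' la => // m IH [|m'] la // lm lm'; rewrite /=; congr (_ - _).
  rewrite !fgliftE big_seq [RHS]big_seq; apply: eq_bigr => x /domD lx.
  by congr (_ *: _); apply: IH; [exact: leq_trans lx lm|exact: leq_trans lx lm'].
exists (fun la => c (rank la).+1 la) => la.
rewrite -[Ucoef (val la)](subrK << la >>) -/(D la) linearD /= fgliftU /= addrC.
rewrite -[RHS](subrK (fglift (c (rank la)) (D la))); congr (_ + _).
rewrite !fgliftE big_seq [RHS]big_seq; apply: eq_bigr => x /domD lx.
by congr (_ *: _); exact: (stab (rank x).+1 (rank la) x (leqnn _) lx).
Qed.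

End Triangularity.

(** * Schur functions *)

Lemma path_cat_nseq x (s : seq nat) m n : path leq x s -> (x <= n)%N ->
  (forall y, y \in s -> y <= n)%N -> path leq x (s ++ nseq m n).
Proof.
elim: s x => [|y s IH] x /=.
  by move=> _; elim: m x => //= m IHm x xn _; rewrite xn IHm.
move=> /andP[-> pys] _ H /=; apply: IH => // [|z zs]; apply: H.
  exact: mem_head.
by rewrite inE zs orbT.
Qed.

Lemma sorted_cat_nseq (s : seq nat) m n : sorted leq s ->
  (forall y, y \in s -> y <= n)%N -> sorted leq (s ++ nseq m n).
Proof.
case: s => [_ _|x s /= pxs H]; first by case: m => //= m; apply: (@path_cat_nseq _ [::]).
apply: path_cat_nseq => // [|z zs]; apply: H; first exact: mem_head.
by rewrite inE zs orbT.
Qed.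

Lemma sorted_split (s : seq nat) n : sorted leq s ->
  (forall y, y \in s -> y < n.+1)%N ->
  s = filter (gtn n) s ++ nseq (size s - size (filter (gtn n) s)) n.
Proof.
elim: s => //= x s IH pxs H.
have Hs y : y \in s -> (y < n.+1)%N by move=> ys; apply: H; rewrite inE ys orbT.
case: ltnP => xn /=; first by rewrite subSS -IH // (path_sorted pxs).
have alln y : y \in x :: s -> y = n.
  move=> ys; apply/eqP; rewrite eqn_leq -ltnS H //= (leq_trans xn) //.
  move: ys; rewrite inE => /orP[/eqP->//|].
  by move: (order_path_min leq_trans pxs) => /allP; apply.
rewrite (_ : filter _ s = [::]) /= ?subn0.
  congr (_ :: _); first by rewrite (alln x) ?mem_head.
  by apply/all_pred1P/allP => y ys /=; rewrite (alln y) // inE ys orbT.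
apply/eqP; rewrite -[_ == _]negbK -has_filter; apply/hasPn => y ys /=.
by rewrite (alln y) ?ltnn // inE ys orbT.
Qed.

(** * Removing the largest entry from tableaux *)

Section Tableaux.
Implicit Types (mu nu : intpart) (a : seq nat) (T : seq (seq nat)) (r c n : nat).

Definition tabs nu a : set (seq (seq nat)) :=
  [set T | is_ssyt nu T /\ has_content T a].

Definition extend n nu T : seq (seq nat) :=
  mkseq (fun r => nth [::] T r ++ nseq (row nu r - size (nth [::] T r)) n)
    (size (val nu)).

Lemma sumn_map_row (f : seq nat -> nat) T M : f [::] = 0%N -> (size T <= M)%N ->
  sumn (map f T) = (\sum_(r < M) f (nth [::] T r))%N.
Proof.
move=> f0 leM; rewrite sumnE big_map (big_nth [::]) big_mkord.
rewrite (big_ord_widen _ (fun r => f (nth [::] T r)) leM) big_mkcond.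
by apply: eq_bigr => r _; case: ltnP => // ge; rewrite nth_default.
Qed.

Lemma count_flatten_row i T M : (size T <= M)%N ->
  count_mem i (flatten T) = (\sum_(r < M) count_mem i (nth [::] T r))%N.
Proof. by move=> leM; rewrite count_flatten (sumn_map_row _ leM). Qed.

Lemma tabs_row mu a T r : tabs mu a T -> size (nth [::] T r) = row mu r.
Proof. by move=> [[sh _ _] _]; rewrite /row -sh nth_shape. Qed.

Lemma tabs_size mu a T : tabs mu a T -> size T = size (val mu).
Proof. by move=> [[sh _ _] _]; rewrite -sh size_map. Qed.

Lemma tabs_sorted mu a T r : tabs mu a T -> sorted leq (nth [::] T r).
Proof.
move=> [[_ srt _] _]; have [lt|ge] := ltnP r (size T).
  exact: (all_nthP [::] srt).
by rewrite nth_default.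
Qed.

Lemma tabs_ltn mu a T r x : tabs mu a T -> x \in nth [::] T r -> (x < size a)%N.
Proof.
move=> [_ cont] xr; rewrite ltnNge; apply/negP => ge.
have := cont x; rewrite nth_default //; apply/eqP; rewrite -lt0n -has_count has_pred1.
apply/flattenP; exists (nth [::] T r) => //; apply: mem_nth.
by rewrite ltnNge; apply/negP => ?; rewrite nth_default in xr.
Qed.

Lemma nth_extend n nu T r : (size T <= size (val nu))%N ->
  nth [::] (extend n nu T) r =
  nth [::] T r ++ nseq (row nu r - size (nth [::] T r)) n.
Proof.
move=> le; have [lt|ge] := ltnP r (size (val nu)); first by rewrite nth_mkseq.
rewrite nth_default ?size_mkseq // [nth _ T r]nth_default ?(leq_trans le) //=.
by have := row_eq0 nu r; rewrite ge => /eqP->.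
Qed.

Lemma hstrip_size mu nu k : hstrip mu nu k -> (size (val mu) <= size (val nu))%N.
Proof.
move=> [_ le _]; rewrite -row_eq0 -leqn0; apply: leq_trans (le _) _.
by rewrite leqn0 row_eq0.
Qed.

Lemma extend_tabs mu nu a k T : hstrip mu nu k -> tabs mu a T ->
  tabs nu (rcons a k) (extend (size a) nu T).
Proof.
move=> st tT; have [il le sz] := st.
have sT : (size T <= size (val nu))%N by rewrite (tabs_size tT) (hstrip_size st).
have rT r := tabs_row r tT.
split; first split.
- apply: (@eq_from_nth _ 0%N) => [|r]; rewrite size_map size_mkseq // => lt.
  rewrite (nth_map [::]) ?size_mkseq // nth_extend // size_cat size_nseq rT.
  by rewrite subnKC.
- apply/(all_nthP [::]) => r _; rewrite nth_extend //.
  apply: sorted_cat_nseq => [|x /(tabs_ltn tT)/ltnW//]; exact: tabs_sorted tT.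
- move=> r c; rewrite !nth_extend // size_cat size_nseq !rT subnKC // => cr.
  rewrite !nth_cat !rT (leq_trans cr (il r)).
  have lt1 : (nth 0 (nth [::] T r) c < size a)%N.
    by apply: (tabs_ltn tT (r := r)); rewrite mem_nth // rT (leq_trans cr (il r)).
  case: (ltnP c (row mu r.+1)) => [lt|ge].
    by have [[_ _ strict] _] := tT; apply: strict; rewrite rT.
  by rewrite nth_nseq ifT // ltn_subLR // subnKC.
- move=> i; have [_ cont] := tT; have := cont i.
  have sz2 : (size (extend (size a) nu T) <= size (val nu))%N by rewrite size_mkseq.
  rewrite (count_flatten_row i sT) (count_flatten_row i sz2) nth_rcons => ci.
  under eq_bigr => r _ do rewrite nth_extend // count_cat count_nseq rT /=.
  rewrite big_split /= ci -big_distrr /=.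
  have -> : (\sum_(r < size (val nu)) (row nu r - row mu r) = k)%N.
    move: sz; rewrite (psize_row (leqnn _)) (psize_row (hstrip_size st)).
    have -> : (\sum_(r < size (val nu)) row nu r =
        \sum_(r < size (val nu)) row mu r +
        \sum_(r < size (val nu)) (row nu r - row mu r))%N.
      by rewrite -big_split; apply: eq_bigr => r _ /=; rewrite subnKC.
    by move/addnI.
  rewrite eq_sym; case: ltngtP => [lt|gt|->]; rewrite ?mul0n ?addn0 //.
    by rewrite nth_default // ltnW.
  by rewrite nth_default // mul1n.
Qed.

(** Deleting the entries [size a] recovers the rows and with them the inner shape. The shapes are
    allowed to differ because tableaux of all inner shapes are later taken together. *)
Lemma extend_inj mu mu' nu a k T T' : hstrip mu nu k -> hstrip mu' nu k ->
  tabs mu a T -> tabs mu' a T' ->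
  extend (size a) nu T = extend (size a) nu T' -> T = T'.
Proof.
move=> st st' tT tT' e.
have rows r : nth [::] T r = nth [::] T' r.
  have := congr1 (fun X => filter (gtn (size a)) (nth [::] X r)) e.
  rewrite /= !nth_extend ?(tabs_size tT) ?(tabs_size tT') ?(hstrip_size st)
    ?(hstrip_size st') // !filter_cat.
  rewrite !(eq_in_filter (a1 := gtn (size a)) (a2 := predT) (s := nth [::] _ r)).
  - rewrite !filter_predT !(eq_in_filter (a1 := gtn (size a)) (a2 := pred0)
      (s := nseq _ _)) => [|x /nseqP[-> _]|x /nseqP[-> _]]; rewrite ?filter_pred0 ?cats0 //=; lia.
  - by move=> x /(tabs_ltn tT').
  - by move=> x /(tabs_ltn tT).
have rowe : mu = mu' by apply: row_inj => r; rewrite -(tabs_row r tT) rows (tabs_row r tT').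
apply: (@eq_from_nth _ [::]) => [|r _]; last exact: rows.
by rewrite (tabs_size tT) (tabs_size tT') rowe.
Qed.

Lemma restrict_tabs nu a k T : tabs nu (rcons a k) T -> exists mu T',
  [/\ hstrip mu nu k, tabs mu a T' & extend (size a) nu T' = T].
Proof.
move=> tT; set n := size a; pose res r := filter (gtn n) (nth [::] T r).
have dec r : nth [::] T r = res r ++ nseq (row nu r - size (res r)) n.
  rewrite -(tabs_row r tT); apply: sorted_split; first exact: tabs_sorted tT.
  by move=> x /(tabs_ltn tT); rewrite size_rcons.
have le r : (size (res r) <= row nu r)%N.
  by rewrite -(tabs_row r tT) size_filter count_size.
have resn r c : (c < size (res r))%N -> nth 0%N (nth [::] T r) c = nth 0%N (res r) c.
  by move=> lt; rewrite dec nth_cat lt.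
(* Otherwise an entry of row [r.+1], at most [n], would lie below an entry equal to [n]. *)
have il r : (row nu r.+1 <= size (res r))%N.
  rewrite leqNgt; apply/negP => lt; have [[_ _ strict] _] := tT.
  have := strict r (size (res r)); rewrite (tabs_row _ tT) => /(_ lt).
  have : (nth 0 (nth [::] T r.+1) (size (res r)) < n.+1)%N.
    rewrite /n -(size_rcons a k); apply: (tabs_ltn tT (r := r.+1)).
    by rewrite mem_nth // (tabs_row _ tT).
  rewrite [nth [::] T r]dec nth_cat ltnn subnn nth_nseq ifT; first by lia.
  by rewrite subn_gt0 (leq_trans lt) // row_nonincr.
have [mu rmu] : exists mu, row mu =1 fun r => size (res r).
  apply: cols_rows; split=> [r|]; first exact: leq_trans (le _) (il r).
  by exists (size (val nu)); apply/eqP; rewrite -leqn0 (leq_trans (le _)) // leqn0 row_eq0.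
pose T' := mkseq res (size (val mu)).
have T'r r : nth [::] T' r = res r.
  have [lt|ge] := ltnP r (size (val mu)); first by rewrite nth_mkseq.
  rewrite nth_default ?size_mkseq //; apply/esym/nilP.
  by rewrite /nilp -rmu row_eq0.
have szmu : (size (val mu) <= size (val nu))%N.
  by rewrite -row_eq0 rmu -leqn0 (leq_trans (le _)) // leqn0 row_eq0.
have sT : (size T <= size (val nu))%N by rewrite (tabs_size tT).
have sT' : (size T' <= size (val nu))%N by rewrite size_mkseq.
have [_ cont] := tT.
exists mu, T'; split.
- split=> [r|r|]; rewrite ?rmu //.
  have := cont n; rewrite (count_flatten_row _ sT) nth_rcons ltnn eqxx => <-.
  rewrite (psize_row (leqnn _)) (psize_row szmu) -big_split.
  apply: eq_bigr => r _ /=; rewrite rmu [nth [::] T r]dec count_cat count_nseq /= eqxx.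
  rewrite (_ : count_mem n (res r) = 0%N) ?add0n ?mul1n ?subnKC //.
  by apply/count_memPn; rewrite mem_filter /= ltnn.
- split; first split.
  + apply: (@eq_from_nth _ 0%N) => [|r]; rewrite size_map size_mkseq // => lt.
    by rewrite (nth_map [::]) ?size_mkseq // T'r -rmu.
  + apply/(all_nthP [::]) => r _; rewrite T'r; apply: sorted_filter.
      exact: leq_trans.
    exact: tabs_sorted tT.
  + move=> r c; rewrite !T'r => lt; rewrite -!resn //; last first.
      exact: leq_trans lt (leq_trans (le _) (il r)).
    have [[_ _ strict] _] := tT; apply: strict; rewrite (tabs_row _ tT).
    exact: leq_trans lt (le _).
  + move=> i; have := cont i; rewrite (count_flatten_row _ sT) (count_flatten_row _ sT').
    rewrite nth_rcons -/n; case: ltnP => [lt <-|ge _].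
      apply: eq_bigr => r _; rewrite T'r [in RHS]dec count_cat count_nseq /=.
      by rewrite (_ : (n == i) = false) ?mul0n ?addn0 //; lia.
    rewrite nth_default // big1 // => r _; rewrite T'r; apply/count_memPn.
    by rewrite mem_filter /= ltnNge ge.
- apply: (@eq_from_nth _ [::]) => [|r _]; first by rewrite size_mkseq (tabs_size tT).
  by rewrite nth_extend // T'r -dec.
Qed.

End Tableaux.

Lemma finite_hstrip nu k : finite_set [set mu | hstrip mu nu k].
Proof.
pose n := size (val nu); pose B := row nu 0.
(* [phi] lists the candidate row lengths; [part0] is the value when no partition has these rows. *)
pose g (phi : {ffun 'I_n -> 'I_B.+1}) : intpart :=
  xget part0 [set mu | (size (val mu) <= n)%N /\ forall r : 'I_n, row mu r = phi r].
apply: (@sub_finite_set _ _ (g @` [set: {ffun 'I_n -> 'I_B.+1}])); last first.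
  exact/finite_image/finite_finset.
move=> mu st; have [_ le _] := st.
have leB r : (row mu r <= B)%N.
  apply: leq_trans (le r) _; rewrite /B; elim: r => // r.
  exact/leq_trans/row_nonincr.
exists [ffun r : 'I_n => inord (row mu r)] => //; rewrite /g.
set A := [set mu | _]; have Amu : A mu.
  split=> [|r]; first exact: hstrip_size st.
  by rewrite ffunE inordK // ltnS.
have : A (xget part0 A) by apply: xgetPex; exists mu.
move=> [sz eqr]; have [szmu eqmu] := Amu; apply: row_inj => r.
have [lt|ge] := ltnP r n; first by rewrite (eqr (Ordinal lt)) (eqmu (Ordinal lt)).
have z la : (size (val la) <= n)%N -> row la r = 0%N.
  by move=> s; apply/eqP; rewrite row_eq0 (leq_trans s).
by rewrite !z.
Qed.

Lemma tabs_inj mu mu' a T : tabs mu a T -> tabs mu' a T -> mu = mu'.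
Proof.
move=> t t'; apply: row_inj => r.
by rewrite -(tabs_row r t) -(tabs_row r t').
Qed.

Lemma tabs_nil nu : tabs nu [::] = [set T | T = [::] /\ nu = part0].
Proof.
apply/seteqP; split=> T /= => [t|[-> ->]]; last first.
  by split=> [|i]; [split=> // r c; rewrite nth_nil|rewrite nth_nil].
have -> : nu = part0.
  apply: row_inj => r; rewrite row_part0 -(tabs_row r t).
  case e : (nth [::] T r) => [//|x s].
  by have := @tabs_ltn _ _ _ r x t; rewrite e mem_head => /(_ isT).
split=> //; apply/eqP; rewrite -size_eq0 (tabs_size t).
rewrite -leqn0 -row_eq0 -(tabs_row _ t).
case e : (nth [::] T 0) => [//|x s].
by have := @tabs_ltn _ _ _ 0 x t; rewrite e mem_head => /(_ isT).
Qed.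

(** Both sides obey the same recursion on the last letter of [a]: deleting the largest possible
    entry from a tableau removes a horizontal strip. *)
Lemma schur_coeff (R : comNzRingType) nu a :
  schur R nu a = coeff nu (opcoef (opA (0 : R)) << part0 >> a).
Proof.
(* Finiteness is part of the induction: it makes [D] finite, as the exchange of sums requires. *)
suff [] : finite_set (tabs nu a) /\ \sum_(T \in tabs nu a) (1 : R) =
  coeff nu (opcoef (opA (0 : R)) << part0 >> a) by [].
elim/last_ind: a nu => [|a k IH] nu.
  rewrite /= coeffU mul1r; have [<-|ne] := eqVneq part0 nu.
    have -> : tabs part0 [::] = [set [::]].
      by rewrite tabs_nil; apply/seteqP; split=> T /= => [[]|].
    by split; [exact: finite_set1|rewrite fsbig_set1].
  have -> : tabs nu [::] = set0.
    rewrite tabs_nil; apply/seteqP; split=> T //= -[_ e].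
    by rewrite e eqxx in ne.
  by split; [exact: finite_set0|rewrite fsbig_set0].
pose H := [set mu | hstrip mu nu k].
pose D := \bigcup_(mu in H) tabs mu a.
have finH : finite_set H by exact: finite_hstrip.
have finD : finite_set D by apply: bigcup_finite => // mu _; case: (IH mu).
have bij : set_bij D (tabs nu (rcons a k)) (extend (size a) nu).
  split.
  - by move=> T [mu st t]; exact: extend_tabs st t.
  - move=> T T' /set_mem[mu st t] /set_mem[mu' st' t'].
    exact: (extend_inj st st' t t').
  - by move=> T /restrict_tabs[mu [T' [st t e]]]; exists T' => //; exists mu.
split.
  have [_ _ surj] := bij; apply: sub_finite_set surj _; exact: finite_image.
rewrite (reindex_fsbig _ _ _ _ bij).
(* A tableau has exactly one shape, so 1 is a sum of indicators over the shapes. *)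
have -> : \sum_(T \in D) (1 : R) =
    \sum_(T \in D) \sum_(mu \in H) (`[< tabs mu a T >]%:R : R).
  apply: eq_fsbigr => T /set_mem[mu st t].
  rewrite (fsbigD1 mu) //= asboolT // fsbig1 ?addr0 // => mu' [_ /= ne].
  by rewrite asboolF // => t'; case: ne; exact: tabs_inj t' t.
rewrite exchange_fsbig //.
rewrite opcoef_rcons coeff_U_sum; set w := opcoef _ _ _.
have -> : \sum_(mu \in H) \sum_(T \in D) (`[< tabs mu a T >]%:R : R) =
    \sum_(mu \in H) coeff mu w.
  apply: eq_fsbigr => mu /set_mem st; have [fin <-] := IH mu.
  rewrite -(@fsbig_widen _ _ _ _ (tabs mu a) D) => [||T [_ /= nt]].
  - by apply: eq_fsbigr => T /set_mem t; rewrite asboolT.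
  - by move=> T t; exists mu.
  - by rewrite asboolF.
rewrite (fsbigE [seq mu <- dom w | `[< hstrip mu nu k >]]).
- rewrite big_filter_cond big_mkcond; apply: eq_bigr => mu _ /=.
  case: asboolP => st; last by rewrite mulr0.
  by rewrite mem_set // mulr1.
- by rewrite filter_uniq // uniq_dom.
- by move=> mu /=; rewrite mem_filter => /andP[/asboolP].
- move=> mu st; rewrite mem_filter asboolT //= mem_dom negbK.
  by move/eqP.
Qed.

(** A vertical strip is a horizontal strip of the conjugates, so transposing all partitions turns
    [opAbar 0] into [opA 0]. *)
Lemma coeff_conj (R : comNzRingType) k (v w : RP R) :
  (forall nu, coeff nu v = coeff (conj_part nu) w) ->
  forall nu, coeff nu (opAbar 0 k v) = coeff (conj_part nu) (opA 0 k w).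
Proof.
move=> vw nu; rewrite coeff_U_sum coeff_linear; last first.
  exact: eh_linH (opA_eh_pair 0) k.
rewrite [RHS](perm_big (map conj_part (dom v))) /=; last first.
  have inj := can_inj conj_partK.
  apply: uniq_perm; rewrite ?(map_inj_uniq inj) ?uniq_dom // => x.
  by rewrite -[x]conj_partK (mem_map inj) !mem_dom vw.
by rewrite [RHS]big_map; apply: eq_bigr => mu _; rewrite coeff_W vw.
Qed.

Lemma schur_conj_coeff (R : comNzRingType) nu a :
  schur R (conj_part nu) a = coeff nu (opcoef (opAbar (0 : R)) << part0 >> a).
Proof.
rewrite schur_coeff; elim/last_ind: a nu => [|a k IH] nu.
  rewrite /= !coeffU; congr (_ * (nat_of_bool _)%:R).
  have c0 : conj_part part0 = part0.
    by apply: row_inj => r; rewrite row_conj row_part0 /collen.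
  by rewrite -{1}c0 (can_eq conj_partK).
by rewrite !opcoef_rcons; apply/esym/coeff_conj => mu; rewrite IH.
Qed.

(** * The exchange of E and H under omega *)

Lemma sort_partP (a : seq nat) : is_part (sort geq (filter (leq 1) a)).
Proof.
rewrite /is_part sort_sorted /=; last by move=> x y; exact: leq_total.
by rewrite mem_sort mem_filter.
Qed.

(** The partition that gives the same word: zeros drop out as $E_0 = 1$, and the order is immaterial
    as the $E_k$ commute. *)
Definition sort_part a : intpart := exist (fun s => is_part s) _ (sort_partP a).

Section MixedWords.
Context (R : comNzRingType) (E H : opser R) (EH : eh_pair E H).
Implicit Types (v : RP R) (a b : seq nat).

Lemma opcoef_swap v a k : opcoef E (E k v) a = E k (opcoef E v a).
Proof. by elim: a v => //= x a IH v; rewrite -IH (eh_comm EH). Qed.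

Lemma opcoef_cons (T : opser R) v k a : opcoef T v (k :: a) = opcoef T (T k v) a.
Proof. by []. Qed.

Lemma opcoef_cat (T : opser R) v a b :
  opcoef T v (a ++ b) = opcoef T (opcoef T v a) b.
Proof. by rewrite /opcoef foldl_cat. Qed.

Lemma opcoef_perm v a b : perm_eq a b -> opcoef E v a = opcoef E v b.
Proof.
elim: a b v => [|x a IH] b v; first by rewrite perm_sym => /perm_nilP->.
move=> p; have xb : x \in b by rewrite -(perm_mem p) mem_head.
case/splitPr: xb p => b1 b2.
rewrite perm_sym -[x :: b2]cat1s perm_catCA /= perm_cons perm_sym => /IH e.
by rewrite e !opcoef_cat opcoef_cons opcoef_swap.
Qed.

Lemma opcoef_filter v a : opcoef E v a = opcoef E v (filter (leq 1) a).
Proof.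
by elim: a v => //= -[|x] a IH v /=; rewrite ?(eh_E0 EH) -IH.
Qed.

Lemma opcoef_sort_part v a : opcoef E v a = opcoef E v (val (sort_part a)).
Proof.
by rewrite opcoef_filter; apply: opcoef_perm; rewrite perm_sym perm_sort.
Qed.

End MixedWords.

Section OmegaExchange.
Context (R : comNzRingType) (E H : opser R) (EH : eh_pair E H).
Local Notation U := (opA (0 : R)).
Local Notation W := (opAbar (0 : R)).

Lemma eh_recursion (E' H' : opser R) (EH' : eh_pair E' H') k v :
  H' k.+1 v = \sum_(i < k.+1) (-1) ^+ i *: H' (k - i)%N (E' i.+1 v).
Proof.
have := eh_inv EH' k v; rewrite big_ord_recl expr0 scale1r subn0 (eh_E0 EH').
move=> /(canRL (addrK _)) ->; rewrite sub0r -sumrN; apply: eq_bigr => i _.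
by rewrite lift0 subSS exprS mulN1r scaleNr opprK.
Qed.

Lemma opcoef_is_linear (T : opser R) a :
  (forall k, linear (T k)) -> linear (opcoef T ^~ a).
Proof.
move=> linT; elim: a => [|k a IH] c v w //.
by rewrite !opcoef_cons linT IH.
Qed.

Lemma opcoef_sum (T : opser R) a n (c : 'I_n -> R) (G : 'I_n -> RP R) :
  (forall k, linear (T k)) ->
  opcoef T (\sum_(i < n) c i *: G i) a = \sum_(i < n) c i *: opcoef T (G i) a.
Proof.
move=> linT.
pose h := GRing.isLinear.Build R _ _ _ _ (opcoef_is_linear a linT).
pose T' : {linear RP R -> RP R} := HB.pack (opcoef T ^~ a) h.
rewrite -[LHS]/(T' _) linear_sum; apply: eq_bigr => i _.
by rewrite linearZ_LR.
Qed.

(* [c] transports the action of [U] and [W] on the empty partition to that of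
   [E] and [H] on [v]; in a word the [E] letters act first, then the [H] ones. *)
Lemma transport_words (c : intpart -> R^o) x v :
  (forall a, fglift c (opcoef U << part0 >> a) = coeff x (opcoef E v a)) ->
  forall a b, fglift c (opcoef W (opcoef U << part0 >> b) a) =
    coeff x (opcoef H (opcoef E v b) a).
Proof.
move=> cE; have UW := opA_eh_pair (0 : R).
elim=> [|k a IHa] b; first exact: cE.
(* The recursion lowers the degree of the first $H$ letter and appends an $E$ letter to [b], so [b]
   varies in this induction; at degree 0 the letter disappears and [a] is shorter. *)
elim/ltn_ind: k b => -[_ b|k IHk b].
  by rewrite !opcoef_cons (eh_H0 UW) (eh_H0 EH); exact: IHa.
rewrite !opcoef_cons (eh_recursion UW) (eh_recursion EH).
rewrite (opcoef_sum (T := W)) ?(opcoef_sum (T := H));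
  [|exact: eh_linH EH|exact: eh_linH UW].
rewrite linear_sum raddf_sum; apply: eq_bigr => i _ /=.
rewrite linearZ_LR coeffZ; congr (_ * _).
have := IHk (k - i)%N _ (rcons b i.+1); rewrite !opcoef_cons !opcoef_rcons; apply.
by rewrite ltnS leq_subr.
Qed.

Lemma fglift_fsum (c : intpart -> R^o) (w : RP R) :
  \sum_(nu \in [set: intpart]) c nu * coeff nu w = fglift c w.
Proof.
rewrite fgliftE (fsbigE (dom w)) ?uniq_dom //=.
  apply: eq_big => [nu|nu _]; first by rewrite in_setT.
  exact: mulrC.
by move=> nu _ /coeff_outdom->; rewrite mulr0.
Qed.

Lemma omega_exchange x v : omega (fun a => coeff x (opcoef E v a)) =
  fun a => coeff x (opcoef H v a).
Proof.
pose f a := coeff x (opcoef E v a).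
pose good := [set c : intpart -> R |
  f = fun a => \sum_(nu \in [set: intpart]) c nu * schur R nu a].
have goodP c : good c <-> forall a, fglift (c : intpart -> R^o)
    (opcoef U << part0 >> a) = f a.
  split=> [gc a|cE]; last first.
    apply/funext => a; rewrite -cE -fglift_fsum; apply: eq_fsbigr => nu _.
    by rewrite schur_coeff.
  rewrite [in RHS]gc -fglift_fsum; apply: eq_fsbigr => nu _.
  by rewrite schur_coeff.
(* [schur_coefs] is a choice, so exhibiting one solution shows that the chosen one is [good]. The
   solution is prescribed on partitions only and extends to all words by symmetry on both sides. *)
have gc : good (schur_coefs f).
  apply: (@xgetPex _ _ good); have [c cE] := Ucoef_solve f.
  exists c; apply/goodP => a.
  rewrite (opcoef_sort_part (opA_eh_pair 0)) cE /f.
  by rewrite [in RHS](opcoef_sort_part EH).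
apply/funext => a; rewrite /omega -/f.
have := transport_words ((goodP _).1 gc) a [::]; rewrite /= => <-.
rewrite -fglift_fsum; apply: eq_fsbigr => nu _.
by rewrite schur_conj_coeff.
Qed.

End OmegaExchange.

Theorem theorem6p2 (R : comNzRingType) (beta : R) (la mu : intpart) :
  omega (Gbeta beta la mu) = Jbeta beta la mu /\
  omega (gbeta beta la mu) = jbeta beta la mu.
Proof.
split; first exact: (omega_exchange (opA_eh_pair beta)).
exact: (omega_exchange (opB_eh_pair beta)).
Qed.
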